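(* Let $r\ge 2$ be an integer. There exist constants $c,C>0$ (depending only on $r$) such that for every integer $n\ge 1$ and every $v\in(0,1]$ with $v\ge c/b_n$ we have $$ \tilde D^{r}_\infty(\mathcal{F}_n,v) \,\le\, C\,\frac{\log(b_n v)}{b_n^r}, $$ where $b_n$ is the $n$th Fibonacci number, $\mathcal{F}_n\subset[0,1)^2$ is the $n$th Fibonacci point set, and $\tilde D^r_\infty(\mathcal{F}_n,v)$ is its periodic $r$-smooth fixed volume $L_\infty$-discrepancy (in dimension $d=2$).
   Context: Here $\mathbb{N}=\{1,2,3,\dots\}$. Fibonacci point set: let $b_0=b_1=1$ and $b_n=b_{n-1}+b_{n-2}$ for $n\ge 2$. For $n\ge 1$, $$ \mathcal{F}_n:=\Big\{\big(\mu/b_n,\{\mu b_{n-1}/b_n\}\big)\colon \mu=1,\dots,b_n\Big\}, $$ where $\{a\}$ is the fractional part of $a$ (and $\mu/b_n=1$ for $\mu=b_n$ is identified with $0$ by periodicity). It has $b_n$ elements. Univariate functions: for $u>0$ let $h^1_u(x):=\chi_{[-u/2,u/2)}(x)$ be the characteristic function of $[-u/2,u/2)$ on $\mathbb{R}$, and for $r\ge 2$ define inductively $h^r_u:=h^{r-1}_u\ast h^1_u$, where $(f\ast g)(x):=\int_{\mathbb{R}}f(x-y)g(y)\,dy$. Boxes: all boxes are $B=\prod_{j=1}^d[z_j-ru_j/2,\,z_j+ru_j/2)$ with $u_j>0$, and $\mathrm{vol}(B)=r^d\prod_{j=1}^d u_j$ is the volume of $B$. For such $B$ set $h^r_B(\mathbf{x}):=\prod_{j=1}^d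 h^r_{u_j}(x_j-z_j)$, $\mathbf{x}\in\mathbb{R}^d$, and let $\tilde h^r_B(\mathbf{x}):=\sum_{\mathbf{m}\in\mathbb{Z}^d}h^r_B(\mathbf{m}+\mathbf{x})$ be its periodization (period $1$ in each variable). Periodic $r$-smooth fixed volume $L_p$-discrepancy: let $\Omega_d:=[0,1)^d$. For $r\in\mathbb{N}$, $1\le p\le\infty$, $v\in(0,1]$ and a point set $\xi=\{\xi^\mu\}_{\mu=1}^m\subset\Omega_d$, $$ \tilde D^{r}_p(\xi,v):=\sup_{B\subset\Omega_d:\,\mathrm{vol}(B)=v}\left\|\int_{\Omega_d}\tilde h^r_B(\mathbf{x}-\mathbf{z})\,d\mathbf{x}-\frac1m\sum_{\mu=1}^m\tilde h^r_B(\xi^\mu-\mathbf{z})\right\|_p, $$ where the supremum is over boxes $B$ of the form $\prod_{j=1}^d[a_j-ru_j/2,\,a_j+ru_j/2)$ with $a_j\in\mathbb{R}$ and $u_j>0$ contained in $\Omega_d$ with volume $v$, and the $L_p$-norm is taken with respect to $\mathbf{z}$ over $\Omega_d$. In the claim $d=2$ and $p=\infty$. *)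

(* Defs.v *)
From mathcomp Require Import all_boot all_order all_algebra.
From mathcomp Require Import all_classical all_reals all_analysis.
From mathcomp Require Import lra.
Set Implicit Arguments.
Unset Strict Implicit.
Unset Printing Implicit Defensive.
Import Order.TTheory GRing.Theory Num.Theory.
Import numFieldNormedType.Exports.
Local Open Scope classical_set_scope.
Local Open Scope ring_scope.

(* Shifted Fibonacci numbers: fib 0 = fib 1 = 1. *)
Fixpoint fib (n : nat) : nat :=
  match n with
  | n'.+1 => match n' with
             | n''.+1 => (fib n' + fib n'')%N
             | 0%N => 1%N
             end
  | 0%N => 1%N
  end.

Definition fracpart (R : realType) (x : R) : R := x - (Num.floor x)%:~R.

(* The index i : 'I_(fib n) stands for mu = i + 1. Taking the fractional part
   of the first coordinate identifies mu / b_n = 1 (mu = b_n) with 0. *)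
Definition fibonacci_points (R : realType) (n : nat) (i : 'I_(fib n)) : R * R :=
  (fracpart (i.+1%:R / (fib n)%:R),
   fracpart (i.+1%:R * (fib n.-1)%:R / (fib n)%:R)).

Definition convolution (R : realType) (f g : R -> R) (x : R) : R :=
  \int[@lebesgue_measure R]_y (f (x - y) * g y).

Definition indic_interval (R : realType) (u : R) : R -> R :=
  \1_(`[- (u / 2), u / 2[ : set R).

(* Meaningful for r >= 1. *)
Definition smooth1 (R : realType) (r : nat) (u : R) : R -> R :=
  iter r.-1 (fun f => convolution f (indic_interval u)) (indic_interval u).

(* A box is given by its center z and by u; its side lengths are r * u.1 and
   r * u.2. *)
Definition box (R : realType) (r : nat) (z u : R * R) : set (R * R) :=
  `[z.1 - r%:R * u.1 / 2, z.1 + r%:R * u.1 / 2[ `*`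
  `[z.2 - r%:R * u.2 / 2, z.2 + r%:R * u.2 / 2[.

Definition box_vol (R : realType) (r : nat) (u : R * R) : R :=
  r%:R ^+ 2 * (u.1 * u.2).

Definition smooth_box (R : realType) (r : nat) (z u x : R * R) : R :=
  smooth1 r u.1 (x.1 - z.1) * smooth1 r u.2 (x.2 - z.2).

(* The sum over Z^2 has only finitely many nonzero terms, see
   [smooth_box_finite_support]; a finitely supported sum \sum_(_ \in _) is
   therefore the actual sum of the series. *)
Definition periodized_smooth_box (R : realType) (r : nat) (z u x : R * R) : R :=
  \sum_(m \in [set: int * int])
    smooth_box r z u (m.1%:~R + x.1, m.2%:~R + x.2).

Definition unit_square (R : realType) : set (R * R) := `[0, 1[ `*` `[0, 1[.

Lemma measurable_unit_square (R : realType) :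
  measurable (@unit_square R : set (measurableTypeR R * measurableTypeR R)).
Proof. by apply: measurableX; exact: measurable_itv. Qed.

Definition lebesgue2 (R : realType) :
    {measure set (measurableTypeR R * measurableTypeR R) -> \bar R} :=
  ((@lebesgue_measure R) \x (@lebesgue_measure R))%E.

Definition lebesgue_unit_square (R : realType) :
    {measure set (measurableTypeR R * measurableTypeR R) -> \bar R} :=
  mrestr (@lebesgue2 R) (@measurable_unit_square R).

Definition quadrature_error (R : realType) (r m : nat) (xi : 'I_m -> R * R)
    (a u z : R * R) : R :=
  \int[@lebesgue2 R]_(x in @unit_square R)
      periodized_smooth_box r a u (x.1 - z.1, x.2 - z.2)
  - m%:R^-1 * \sum_(i < m)
      periodized_smooth_box r a u ((xi i).1 - z.1, (xi i).2 - z.2).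

Definition admissible_box (R : realType) (r : nat) (v : R)
    (au : (R * R) * (R * R)) : Prop :=
  [/\ 0 < au.2.1, 0 < au.2.2, box r au.1 au.2 `<=` @unit_square R
    & box_vol r au.2 = v].

(* The L_p norm is with respect to z; for p = +oo it is the essential
   supremum of the absolute value. *)
Definition smooth_discrepancy (R : realType) (r : nat) (p : \bar R) (m : nat)
    (xi : 'I_m -> R * R) (v : R) : \bar R :=
  ereal_sup [set Lnorm (@lebesgue_unit_square R) p
                   (fun z => (quadrature_error r xi au.1 au.2 z)%:E)
            | au in admissible_box r v].

Lemma fracpart_itv (R : realType) (x : R) : fracpart x \in `[0, 1[.
Proof.
rewrite in_itv/= /fracpart subr_ge0 floor_le/= ltrBlDl.
by have := floorD1_gt x; rewrite intrD.
Qed.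

Lemma fib_gt0 n : (0 < fib n)%N.
Proof. by elim: n => [//|[//|n] IH] /=; rewrite addn_gt0 IH. Qed.

Lemma fibonacci_points_unit_square (R : realType) n (i : 'I_(fib n)) :
  @unit_square R (fibonacci_points R i).
Proof. by split; rewrite /= fracpart_itv. Qed.

Lemma fibonacci_points_inj (R : realType) n :
  injective (@fibonacci_points R n).
Proof.
have b0 : 0 < (fib n)%:R :> R by rewrite ltr0n fib_gt0.
have small (i : nat) : (i.+1 < fib n)%N ->
    fracpart (i.+1%:R / (fib n)%:R : R) = i.+1%:R / (fib n)%:R.
  move=> ib; rewrite /fracpart (_ : Num.floor _ = 0) ?subr0//.
  apply: floor_def; rewrite add0r mulr0z mulr1z divr_ge0 ?ler0n//=.
  by rewrite ltr_pdivrMr// mul1r ltr_nat.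
have large (i : nat) : i.+1 = fib n ->
    fracpart (i.+1%:R / (fib n)%:R : R) = 0.
  by move=> ->; rewrite divff ?gt_eqF// /fracpart floor1 subrr.
have pos (i : nat) : i.+1%:R / (fib n)%:R != 0 :> R.
  by rewrite gt_eqF// divr_gt0// ltr0n.
move=> i j [+ _]; apply: contra_eq => ij.
have := ltn_ord i; rewrite leq_eqVlt => /predU1P[ib|ib];
have := ltn_ord j; rewrite leq_eqVlt => /predU1P[jb|jb].
- by case/eqP: ij; apply/val_inj/succn_inj; exact: etrans ib (esym jb).
- by rewrite (large _ ib) (small _ jb) eq_sym.
- by rewrite (large _ jb) (small _ ib).
- rewrite (small _ ib) (small _ jb); apply: contra ij => /eqP.
  move=> /(mulIf (invr_neq0 (lt0r_neq0 b0))) /eqP; rewrite eqr_nat.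
  by move=> /eqP[] /val_inj ->.
Qed.

Lemma smooth1_support (R : realType) (r : nat) (u x : R) : (0 < r)%N ->
  r%:R * u / 2 < `|x| -> smooth1 r u x = 0.
Proof.
case: r => // k _; rewrite /smooth1/=; elim: k x => [|k IH] x.
  rewrite mul1r/= /indic_interval indicE => ux; rewrite memNset//=.
  rewrite in_itv/= => /andP[x1 x2]; have : `|x| <= u / 2.
    by rewrite ler_norml x1 ltW.
  by rewrite leNgt ux.
rewrite /= => ux; rewrite /convolution.
under eq_Rintegral => y _.
  rewrite (_ : _ * _ = 0); first over.
  rewrite /indic_interval indicE; case: (boolP (y \in _)) => [|_]; last by rewrite mulr0.
  rewrite inE/= in_itv/= => /andP[y1 y2].
  rewrite IH ?mul0r//.
  have yu : `|y| <= u / 2 by rewrite ler_norml y1 ltW.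
  have := ler_normD (x - y) y; rewrite subrK.
  move: ux; rewrite -[k.+2%:R]natr1; set K := k.+1%:R.
  move: yu; lra.
by rewrite Rintegral_cst//= ?mul0r.
Qed.

Lemma smooth_box_finite_support (R : realType) (r : nat) (z u x : R * R) :
  (0 < r)%N ->
  finite_set [set m : int * int |
    smooth_box r z u (m.1%:~R + x.1, m.2%:~R + x.2) != 0].
Proof.
move=> r0.
have fin (c B : R) : finite_set [set m : int | `|m%:~R + c| <= B].
  have [N BN] : exists N : nat, B + `|c| < N%:R.
    exists (Num.bound `|B + `|c| |).
    by rewrite (le_lt_trans (ler_norm _))// archi_boundP.
  apply: (@sub_finite_set _ _
    ((fun k => Posz k) @` `I_N `|` (fun k => - Posz k) @` `I_N)); last first.
    by rewrite finite_setU; split; apply: finite_image; exact: finite_II.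
  move=> m /= mB; have mN : (absz m < N)%N.
    rewrite -(ltr_nat R) natr_absz intr_norm (le_lt_trans _ BN)//.
    have := ler_normB (m%:~R + c) c; rewrite addrK => /le_trans; apply.
    by rewrite lerD2r.
  by case: (intP m) mN => [|k|k] kN; [left; exists 0%N|left; exists k.+1
    |right; exists k.+1].
apply: (@sub_finite_set _ _
  ([set m : int | `|m%:~R + (x.1 - z.1)| <= r%:R * u.1 / 2] `*`
   [set m : int | `|m%:~R + (x.2 - z.2)| <= r%:R * u.2 / 2])); last first.
  by apply: finite_setX; exact: fin.
move=> m /=; rewrite /smooth_box mulf_eq0 negb_or /= => /andP[m1 m2].
by split; rewrite /= leNgt addrA;
  [apply: contra m1|apply: contra m2] => /(smooth1_support r0)->.
Qed.

(* Main.v *)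
Require Import Defs.
From mathcomp Require Import all_boot all_order all_algebra.
From mathcomp Require Import all_classical all_reals all_analysis.
From mathcomp Require Import measurable_realfun ess_sup_inf lra ring zify.
Set Implicit Arguments.
Unset Strict Implicit.
Unset Printing Implicit Defensive.
Import Order.TTheory GRing.Theory Num.Theory.
Import numFieldNormedType.Exports.
Local Open Scope classical_set_scope.
Local Open Scope ring_scope.

(** The 1-periodization of [smooth1 r u] has the Fourier coefficients
    (sin (pi k u) / (pi k))^r. Averaging a product of two such series over the
    Fibonacci lattice leaves only the frequencies (k, l) of the dual lattice,
    k + b_{n-1} l = 0 mod b_n, so the quadrature error is at most a constant times the sum of
    max(1/u_1, |k|)^-r max(1/u_2, |l|)^-r over the nonzero dual points. The norm
    form x^2 - x y - y^2 of the golden ratio gives k^2 + l^2 + 3 b_n |k l| >= b_n^2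
    there, hence dual points whose first coordinates differ by at most
    X have second coordinates separated by b_n / (6 X). Each of the O(log (b_n v))
    dyadic strips k < 2^j / u_1 below b_n u_2 / 2 contributes O(b_n^-r), and so do
    all the strips of width b_n u_2 / 2 beyond together. Only finite trigonometric
    sums are used: the Fourier expansion is replaced by the uniform bound
    |smooth1 r u x - spline_sum r u K x| = O(1/K), with K sent to infinity at the
    end. *)

(** * The Fourier expansion of the parabola *)

(** The product [2 * sin (t / 2) * cos (k t)] is the difference of the sines at [(k + 1/2) t] and
    [(k - 1/2) t], so the sum telescopes. *)
Lemma dirichlet_kernel (R : realType) (N : nat) (t : R) :
  2 * sin (t / 2) * (2^-1 + \sum_(k < N) cos (k.+1%:R * t)) =
  sin ((N%:R + 2^-1) * t).
Proof.
elim: N => [|N IH].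
  by rewrite big_ord0 addr0 add0r -mulrA mulrCA divff// mulr1 mulrC.
rewrite big_ord_recr/= addrA mulrDr IH.
have -> : (N%:R + 2^-1) * t = N.+1%:R * t - t / 2 by rewrite -[N.+1%:R]natr1; field.
have -> : (N.+1%:R + 2^-1) * t = N.+1%:R * t + t / 2 by field.
by rewrite sinB sinD; ring.
Qed.

Definition cos_sum (R : realType) (N : nat) (t : R) : R :=
  \sum_(k < N) cos (k.+1%:R * t) / k.+1%:R ^+ 2.

Definition sin_sum (R : realType) (N : nat) (t : R) : R :=
  \sum_(k < N) sin (k.+1%:R * t) / k.+1%:R.

Lemma is_derive_scale (R : realType) (a t : R) : is_derive t 1 ( *%R a) a.
Proof.
have := @is_deriveZ _ _ _ id a t 1 1 (is_derive_id t 1).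
by rewrite /GRing.scale/= mulr1.
Qed.

Lemma is_derive_scaled_cos (R : realType) (a t : R) :
  is_derive t 1 (fun t => cos (a * t)) (- (a * sin (a * t))).
Proof.
rewrite mulrC -mulNr; apply: (@is_derive1_comp _ cos ( *%R a) t).
exact: is_derive_scale.
Qed.

Lemma is_derive_scaled_sin (R : realType) (a t : R) :
  is_derive t 1 (fun t => sin (a * t)) (a * cos (a * t)).
Proof.
rewrite mulrC; apply: (@is_derive1_comp _ sin ( *%R a) t).
exact: is_derive_scale.
Qed.

Lemma is_derive_sum_cos (R : realType) (N : nat) (c a : 'I_N -> R) (t : R) :
  is_derive t 1 (fun t => \sum_(k < N) c k * cos (a k * t))
    (- \sum_(k < N) c k * a k * sin (a k * t)).
Proof.
rewrite (_ : (fun t => _) = \sum_(k < N) (fun t => c k * cos (a k * t))); last first.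
  by apply/funext => s; rewrite fct_sumE.
rewrite -sumrN; apply: is_derive_sum => k.
rewrite -mulrA -mulrN.
exact: (@is_deriveZ _ _ _ _ (c k) t 1 _ (is_derive_scaled_cos (a k) t)).
Qed.

Lemma is_derive_sum_sin (R : realType) (N : nat) (c a : 'I_N -> R) (t : R) :
  is_derive t 1 (fun t => \sum_(k < N) c k * sin (a k * t))
    (\sum_(k < N) c k * a k * cos (a k * t)).
Proof.
rewrite (_ : (fun t => _) = \sum_(k < N) (fun t => c k * sin (a k * t))); last first.
  by apply/funext => s; rewrite fct_sumE.
apply: is_derive_sum => k; rewrite -mulrA.
exact: (@is_deriveZ _ _ _ _ (c k) t 1 _ (is_derive_scaled_sin (a k) t)).
Qed.

Lemma is_derive_cos_sum (R : realType) (N : nat) (t : R) :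
  is_derive t 1 (@cos_sum R N) (- sin_sum N t).
Proof.
have := is_derive_sum_cos (fun k : 'I_N => (k.+1%:R ^+ 2)^-1) (fun k => k.+1%:R) t.
rewrite (_ : (fun t => _) = @cos_sum R N); last first.
  by apply/funext => s; apply: eq_bigr => k _; rewrite mulrC.
move=> H; apply: is_derive_eq H _; congr (- _); apply: eq_bigr => k _.
by field; rewrite nat1r pnatr_eq0.
Qed.

Lemma is_derive_sin_sum (R : realType) (N : nat) (t : R) :
  is_derive t 1 (@sin_sum R N) (\sum_(k < N) cos (k.+1%:R * t)).
Proof.
have := is_derive_sum_sin (fun k : 'I_N => k.+1%:R^-1) (fun k => k.+1%:R) t.
rewrite (_ : (fun t => _) = @sin_sum R N); last first.
  by apply/funext => s; apply: eq_bigr => k _; rewrite mulrC.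
move=> H; apply: is_derive_eq H _; apply: eq_bigr => k _.
by rewrite mulVf ?mul1r ?pnatr_eq0.
Qed.

Lemma mean_value_bound (R : realType) (f df : R -> R) (M a b : R) : a <= b ->
  (forall x, x \in `[a, b] -> is_derive x 1 f (df x)) ->
  (forall x, x \in `[a, b] -> `|df x| <= M) ->
  `|f b - f a| <= M * (b - a).
Proof.
move=> ab fdf dfM.
have fdf' x : x \in `]a, b[ -> is_derive x 1 f (df x).
  by move=> xab; apply: fdf; exact: subset_itv_oo_cc.
have fc : {within `[a, b], continuous f}.
  by apply: derivable_within_continuous => x /fdf [].
have [c cab ->] := MVT_segment ab fdf' fc.
by rewrite normrM (ger0_norm (_ : 0 <= b - a)) ?subr_ge0// ler_wpM2r ?subr_ge0// dfM.
Qed.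

(* [(pi - t) / 2 - sin_sum N t] has the derivative [- sin (m t) / (2 sin (t / 2))], of
   order 1 in [N]; subtracting the main term of its integration by parts leaves a
   derivative of order [1 / m]. *)
Lemma is_derive_sin_sum_corrected (R : realType) (N : nat) (t : R) :
  let m := N%:R + 2^-1 in sin (t / 2) != 0 ->
  is_derive t 1
    (fun t => (pi - t) / 2 - sin_sum N t - cos (m * t) / (2 * m * sin (2^-1 * t)))
    (cos (m * t) * cos (t / 2) / (4 * m * sin (t / 2) ^+ 2)).
Proof.
move=> m s0.
have m0 : m != 0 by rewrite gt_eqF// ltr_wpDl// invr_gt0.
have s0' : 2 * m * sin (2^-1 * t) != 0.
  by rewrite mulf_neq0 ?mulf_neq0 ?pnatr_eq0// mulrC.
have D1 := @is_deriveZ _ _ _ _ (2 * m) t 1 _ (is_derive_scaled_sin 2^-1 t).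
have D2 := @is_deriveV _ _ t _ _ s0' D1.
have D3 := is_deriveM (is_derive_scaled_cos m t) D2.
have D4 := is_deriveB (is_derive_cst pi t 1) (is_derive_id t 1).
have D5 := @is_deriveZ _ _ _ _ 2^-1 t 1 _ D4.
have D6 := is_deriveB (is_deriveB D5 (is_derive_sin_sum N t)) D3.
have -> : (fun t => (pi - t) / 2 - sin_sum N t - cos (m * t) / (2 * m * sin (2^-1 * t))) =
  2^-1 *: (cst pi - id) - @sin_sum R N -
        (fun t : R => cos (m * t)) * (fun y : R => ((2 * m *: (fun t : R => sin (2^-1 * t))) y)^-1).
  by apply/funext => s; rewrite /GRing.scale/= [_ / 2]mulrC.
apply: is_derive_eq D6 _.
rewrite /GRing.scale/= /GRing.scale/= !(mulrC 2^-1 t).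
have := dirichlet_kernel N t; rewrite -/m => H.
have -> : \sum_(k < N) cos (k.+1%:R * t) = sin (m * t) / (2 * sin (t / 2)) - 2^-1.
  by rewrite -H; field.
move: m0; rewrite -/m; move: (m) => m1 m0.
by field; rewrite m0 s0.
Qed.

Lemma sin_natpi (R : realType) (k : nat) : sin (k%:R * pi) = 0 :> R.
Proof.
elim: k => [|k IH]; first by rewrite mul0r sin0.
by rewrite -natr1 mulrDl mul1r sinDpi IH oppr0.
Qed.

Lemma is_derive_cos_sumB_parabola (R : realType) (N : nat) (t : R) :
  is_derive t 1 (fun t => cos_sum N t - (pi - t) ^+ 2 / 4)
    ((pi - t) / 2 - sin_sum N t).
Proof.
have D4 := is_deriveB (is_derive_cst pi t 1) (is_derive_id t 1).
have D5 := @is_deriveZ _ _ _ _ 4^-1 t 1 _ (is_deriveX 2 D4).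
have D6 := is_deriveB (is_derive_cos_sum N t) D5.
rewrite (_ : (fun t => _) = @cos_sum R N - 4^-1 *: (cst pi - id) ^+ 2); last first.
  by apply/funext => s; rewrite /GRing.scale/= mulrC.
apply: is_derive_eq D6 _.
by rewrite /GRing.scale/= -[(cst pi - id) t]/(pi - t) expr1; field.
Qed.

(** Two integrations starting at [pi], each by the mean value inequality. Subtracting the value at
    [pi] spares the evaluation of the sum of [1 / k^2]. The constant blows up as [t] tends to 0,
    which is harmless since it only serves in the limit [N -> oo]. *)
Lemma cos_sum_parabola_interior (R : realType) (N : nat) (t : R) :
  0 < t -> t <= pi ->
  `|cos_sum N t - cos_sum N pi - (pi - t) ^+ 2 / 4|
    <= (pi / 4 + 2^-1) * pi / sin (t / 2) ^+ 2 / (N%:R + 2^-1).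
Proof.
move=> t0 tpi; set s := sin (t / 2); set m := N%:R + 2^-1.
have m0 : 0 < m by rewrite ltr_wpDl// invr_gt0.
have sE x : x \in `[t, pi] -> s <= sin (x / 2).
  rewrite in_itv/= => /andP[tx xpi].
  by rewrite leNgt ltr_sin ?in_itv/= -?leNgt ?ler_pM2r//; apply/andP; split; lra.
have pi0 := pi_gt0 R.
have s0 : 0 < s by apply: sin_gt0_pi; lra.
have s1 : s <= 1 by exact: sin_le1.
have ms0 : 0 < m * s ^+ 2 by rewrite mulr_gt0 // exprn_gt0.
pose V := fun t : R => (pi - t) / 2 - sin_sum N t - cos (m * t) / (2 * m * sin (2^-1 * t)).
have Vpi : V pi = 0.
  rewrite /V subrr mul0r sub0r.
  have -> : sin_sum N pi = 0 :> R.
    by rewrite /sin_sum big1// => k _; rewrite sin_natpi mul0r.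
  rewrite oppr0 /m mulrDl cosD sin_natpi mul0r subr0 [2^-1 * pi]mulrC.
  by rewrite cos_pihalf mulr0 mul0r subr0.
have Vx x : x \in `[t, pi] -> `|V x| <= pi / (4 * (m * s ^+ 2)).
  move=> xt; have := xt; rewrite in_itv/= => /andP[tx xpi].
  have xsub y : y \in `[x, pi] -> y \in `[t, pi].
    by rewrite !in_itv/= => /andP[/(le_trans tx) -> ->].
  have D y : y \in `[x, pi] -> is_derive y 1 V
      (cos (m * y) * cos (y / 2) / (4 * m * sin (y / 2) ^+ 2)).
    move=> /xsub yt; apply: is_derive_sin_sum_corrected.
    by rewrite gt_eqF// (lt_le_trans s0)// sE.
  have B y : y \in `[x, pi] ->
      `|cos (m * y) * cos (y / 2) / (4 * m * sin (y / 2) ^+ 2)| <= (4 * (m * s ^+ 2))^-1.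
    move=> /xsub yt; have sy := sE _ yt.
    have sy0 : 0 < sin (y / 2) by rewrite (lt_le_trans s0).
    have p0 : 0 < 4 * m * sin (y / 2) ^+ 2 by rewrite !mulr_gt0// exprn_gt0.
    rewrite normrM normfV (gtr0_norm p0) normrM.
    rewrite -[leRHS]mul1r ler_pM ?mulr_ge0 ?invr_ge0 ?(ltW p0)//.
      by rewrite -[leRHS]mulr1 ler_pM// cos_max.
    rewrite lef_pV2 ?posrE ?mulr_gt0// mulrA ler_pM2l ?mulr_gt0//.
    by rewrite lerXn2r// nnegrE ltW.
  have := mean_value_bound xpi D B; rewrite Vpi sub0r normrN => /le_trans; apply.
  by rewrite mulrC ler_wpM2r ?invr_ge0 ?mulr_ge0 ?(ltW ms0)//; lra.
have C x : x \in `[t, pi] ->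
    `|(pi - x) / 2 - sin_sum N x| <= (pi / 4 + 2^-1) / (m * s ^+ 2).
  move=> xt; have -> : (pi - x) / 2 - sin_sum N x =
     V x + cos (m * x) / (2 * m * sin (2^-1 * x)) by rewrite /V subrK.
  have sx := sE _ xt; have sx0 : 0 < sin (x / 2) by rewrite (lt_le_trans s0).
  rewrite (le_trans (ler_normD _ _))// [leRHS]mulrDl lerD//.
    by rewrite (le_trans (Vx _ xt))// invfM mulrA.
  rewrite [2^-1 * x]mulrC.
  have p0 : 0 < 2 * m * sin (x / 2) by rewrite !mulr_gt0.
  rewrite normrM normfV (gtr0_norm p0) -invfM.
  rewrite -[leRHS]mul1r ler_pM ?invr_ge0 ?(ltW p0)// ?cos_max//.
  rewrite lef_pV2 ?posrE ?mulr_gt0 ?exprn_gt0// mulrA ler_pM2l ?mulr_gt0//.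
  by rewrite (le_trans _ sx)// expr2 -[leRHS]mulr1 ler_pM2l.
have := @mean_value_bound R _ _ _ t pi tpi (fun x _ => is_derive_cos_sumB_parabola N x) C.
rewrite subrr expr0n/= mul0r subr0.
rewrite -normrN opprB addrAC => /le_trans; apply.
rewrite (_ : _ / m = (pi / 4 + 2^-1) / (m * s ^+ 2) * pi); last first.
  by rewrite [(m * _)^-1]invfM; ring.
by rewrite ler_pM2l ?divr_gt0//; lra.
Qed.

(** Telescoping, by [1 / (k + 1)^2 <= 1 / k - 1 / (k + 1)]. *)
Lemma cos_sum_tail (R : realType) (K N : nat) (t : R) : (0 < K)%N -> (K <= N)%N ->
  `|cos_sum N t - cos_sum K t| <= K%:R^-1.
Proof.
move=> K0 /subnKC <-; move: (N - K)%N => {N} j.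
have : `|cos_sum (K + j) t - cos_sum K t| <= K%:R^-1 - (K + j)%:R^-1.
  elim: j => [|j IH]; first by rewrite addn0 !subrr normr0.
  rewrite addnS /cos_sum big_ord_recr/= -/(cos_sum _ _) -/(cos_sum _ _) addrAC.
  rewrite (le_trans (ler_normD _ _))//.
  rewrite (_ : _ - (K + j).+1%:R^-1 = (K%:R^-1 - (K + j)%:R^-1) +
    ((K + j)%:R^-1 - (K + j).+1%:R^-1)); last by ring.
  rewrite lerD// normrM -[leRHS]mul1r normfV.
  have k0 : 0 < (K + j)%:R :> R by rewrite ltr0n addn_gt0 K0.
  rewrite [X in _ / X]gtr0_norm ?exprn_gt0//.
  move: k0; rewrite -[(K + j).+1%:R]natr1; set x : R := (K + j)%:R => k0.
  rewrite ler_pM ?cos_max ?invr_ge0 ?exprn_ge0 ?addr_ge0 ?(ltW k0)//.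
  rewrite (_ : _ - _ = (x * (x + 1))^-1); last by field; lra.
  by rewrite lef_pV2 ?posrE ?exprn_gt0 ?mulr_gt0//; nra.
by move=> /le_trans; apply; rewrite gerBl.
Qed.

Lemma norm_add3 (R : realType) (a b c A B C : R) :
  `|a| <= A -> `|b| <= B -> `|c| <= C -> `|a - b + c| <= B + C + A.
Proof. by rewrite !ler_norml; lra. Qed.

(** Stands in for the passage to the limit [N -> oo]. *)
Lemma norm_le_div_nat (R : realType) (x a M c : R) :
  (forall N : nat, `|x| <= a + M / (N%:R + c)) -> 0 <= M -> 0 < c -> `|x| <= a.
Proof.
move=> H M0 c0; apply/ler_addgt0Pr => e e0.
have [N NM] : exists N : nat, M / e < N%:R.
  exists (Num.bound (M / e)).
  by rewrite archi_boundP// divr_ge0// ltW.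
rewrite (le_trans (H N))// lerD2l ler_pdivrMr ?ltr_wpDl//.
by move: NM; rewrite ltr_pdivrMr//; nra.
Qed.

Lemma cos_sum_parabola_half (R : realType) (K : nat) (t : R) : (0 < K)%N ->
  0 <= t -> t <= pi ->
  `|cos_sum K t - cos_sum K pi - (pi - t) ^+ 2 / 4| <= 2 / K%:R.
Proof.
move=> K0; have pi0 := pi_gt0 R.
have k0 : 0 < K%:R :> R by rewrite ltr0n.
have pos (s : R) : 0 < s -> s <= pi ->
    `|cos_sum K s - cos_sum K pi - (pi - s) ^+ 2 / 4| <= 2 / K%:R.
  move=> s0 spi.
  set M := (pi / 4 + 2^-1) * pi / sin (s / 2) ^+ 2.
  have M0 : 0 <= M.
    rewrite /M divr_ge0//; last by rewrite exprn_even_ge0.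
    by rewrite mulr_ge0 ?(ltW pi0)//; lra.
  (* The sum of length [N + K] is within [1 / K] of the one of length [K], both at [s] and at [pi];
     letting [N] grow removes [M], which depends on [s]. *)
  apply: (@norm_le_div_nat _ _ _ M (K%:R + 2^-1)) => //.
  move=> N; have NK : (K <= N + K)%N by rewrite leq_addl.
  have H1 := cos_sum_tail s K0 NK; have H2 := cos_sum_tail (pi : R) K0 NK.
  have := cos_sum_parabola_interior (N + K) s0 spi; rewrite -/M natrD addrA => H3.
  rewrite (_ : _ - _ / 4 = (cos_sum (N + K) s - cos_sum (N + K) pi - (pi - s) ^+ 2 / 4)
    - (cos_sum (N + K) s - cos_sum K s) + (cos_sum (N + K) pi - cos_sum K pi)); last by ring.
  rewrite (_ : 2 / K%:R = K%:R^-1 + K%:R^-1); last by rewrite mulr_natl mulr2n.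
  exact: norm_add3.
rewrite le_eqVlt => /predU1P[<- _|]; last exact: pos.
(* At [t = 0] the bound is carried over from [s = pi / (N + 1)]: the crude slope bound [K + pi] on
   [[0, s]] costs a multiple of [1 / (N + 1)]. *)
apply: (@norm_le_div_nat _ _ _ (pi * (K%:R + pi)) 1) => //; last first.
  have A : 0 <= pi :> R by exact: ltW pi0.
  have B : 0 <= K%:R + pi :> R by rewrite addr_ge0.
  exact: mulr_ge0.
move=> N.
pose s : R := pi / (N%:R + 1).
have N1 : 1 <= N%:R + 1 :> R by rewrite lerDr.
have s0 : 0 < s by rewrite divr_gt0//; lra.
have spi : s <= pi by rewrite ler_pdivrMr ?ler_peMr//; lra.
have B (x : R) : x \in `[0, s] -> `|(pi - x) / 2 - sin_sum K x| <= K%:R + pi.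
  rewrite in_itv/= => /andP[x0 xs].
  rewrite (le_trans (ler_normB _ _))// addrC lerD//; last by rewrite ger0_norm; lra.
  rewrite (le_trans (ler_norm_sum _ _ _))//.
  rewrite (_ : K%:R = \sum_(i < K) (1 : R)); last by rewrite sumr_const card_ord.
  apply: ler_sum => i _; rewrite normrM -[leRHS]mulr1 ler_pM ?sin_max//.
  by rewrite normfV ger0_norm ?ler0n// invf_le1 ?ltr0n// ler1n.
have := @mean_value_bound R _ _ _ _ _ (ltW s0)
   (fun x _ => is_derive_cos_sumB_parabola K x) B.
have := pos s s0 spi.
set X := _ - _ / 4; set Y := cos_sum K s - _; set Z := _ - _ / 4.
move=> HX HY.
rewrite (_ : cos_sum K 0 - cos_sum K pi - (pi - 0) ^+ 2 / 4 = X - (Y - Z)); last first.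
  by rewrite /X/Y/Z; ring.
rewrite (le_trans (ler_normB _ _))// lerD// (le_trans HY)//.
by rewrite subr0 /s mulrA [(K%:R + pi) * _]mulrC.
Qed.

Lemma cos_natmul_2pi (R : realType) (k : nat) (t : R) :
  cos (k%:R * (pi *+ 2) + t) = cos t.
Proof.
elim: k => [|k IH]; first by rewrite mul0r add0r.
by rewrite -natr1 mulrDl mul1r -addrA [_ *+ 2 + t]addrC addrA cosD2pi.
Qed.

(** Evenness and the symmetry [x -> 1 - x] reduce the claim to [0 <= x <= 1/2]. *)
Lemma cos_sum_parabola (R : realType) (K : nat) (x : R) : (0 < K)%N -> `|x| <= 1 ->
  `|cos_sum K (2 * pi * x) - cos_sum K pi - pi ^+ 2 * (4^-1 - `|x| + x ^+ 2)|
    <= 2 / K%:R.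
Proof.
move=> K0; have pi0 := pi_gt0 R.
wlog x0 : x / 0 <= x.
  move=> H; have [/H//|x0] := lerP 0 x.
  have := H (- x); rewrite normrN sqrrN oppr_ge0 => /(_ (ltW x0)).
  have -> // : cos_sum K (2 * pi * - x) = cos_sum K (2 * pi * x).
  by rewrite /cos_sum; apply: eq_bigr => i _; rewrite !mulrN cosN.
rewrite ger0_norm// => x1.
have [x2|x2] := lerP x 2^-1.
  have -> : pi ^+ 2 * (4^-1 - x + x ^+ 2) = (pi - 2 * pi * x) ^+ 2 / 4 by field.
  by apply: cos_sum_parabola_half => //; nra.
have -> : pi ^+ 2 * (4^-1 - x + x ^+ 2) = (pi - 2 * pi * (1 - x)) ^+ 2 / 4 by field.
have -> : cos_sum K (2 * pi * x) = cos_sum K (2 * pi * (1 - x)).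
  rewrite /cos_sum; apply: eq_bigr => i _; congr (_ / _).
  rewrite -cosN -(cos_natmul_2pi i.+1); congr cos; ring.
by apply: cos_sum_parabola_half => //; nra.
Qed.

(* Partial Fourier sum of the 1-periodization of [smooth1 r u]. *)
Definition spline_sum (R : realType) (r : nat) (u : R) (K : nat) (x : R) : R :=
  u ^+ r + 2 * \sum_(k < K)
    (sin (pi * k.+1%:R * u) / (pi * k.+1%:R)) ^+ r * cos (2 * pi * k.+1%:R * x).

(** The weights [sin (pi k u) ^ 2 = (1 - cos (2 pi k u)) / 2] act on [cos_sum] as a second
    difference of step [u], up to a factor. *)
Lemma spline_sum2E (R : realType) (u : R) (K : nat) (x : R) :
  spline_sum 2 u K x = u ^+ 2 + (pi ^+ 2)^-1 *
    (cos_sum K (2 * pi * x) - cos_sum K (2 * pi * (x + u)) / 2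
     - cos_sum K (2 * pi * (x - u)) / 2).
Proof.
have pi0 := pi_gt0 R.
rewrite /spline_sum; congr (_ + _).
rewrite /cos_sum mulr_sumr !mulr_suml -!sumrB mulr_sumr; apply: eq_bigr => k _.
set a := k.+1%:R; have a0 : a != 0 by rewrite pnatr_eq0.
clearbody a.
have -> : a * (2 * pi * x) = 2 * pi * a * x by ring.
have -> : a * (2 * pi * (x + u)) = 2 * pi * a * x + (pi * a * u) *+ 2 by ring.
have -> : a * (2 * pi * (x - u)) = 2 * pi * a * x - (pi * a * u) *+ 2 by ring.
rewrite cosD cosB cos_mulr2n expr_div_n sin2cos2.
have pi0' : pi != 0 :> R by rewrite gt_eqF.
by move: (pi : R) pi0' => p p0; field; rewrite a0.
Qed.

(** The second difference of [spline_sum2E] is applied to the parabola: constants cancel, so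
    [cos_sum K pi] drops out, [x ^+ 2] yields the mean [u ^+ 2], and the absolute value yields the
    triangle. The condition on [x] keeps [x - u] and [x + u] in [[-1, 1]]. *)
Lemma triangle_spline_sum (R : realType) (u : R) (K : nat) (x : R) : (0 < K)%N ->
  0 < u -> `|x| <= 1 - u ->
  `|Num.max 0 (u - `|x|) - spline_sum 2 u K x| <= 4 / K%:R.
Proof.
move=> K0 u0 xu.
have k0 : 0 < K%:R :> R by rewrite ltr0n.
have K1 : 0 < K%:R^-1 :> R by rewrite invr_gt0.
have pi2 := pi_ge2 R.
have := xu; rewrite ler_norml => /andP[xu1 xu2].
have H0 := @cos_sum_parabola R K x K0.
have H1 := @cos_sum_parabola R K (x + u) K0.
have H2 := @cos_sum_parabola R K (x - u) K0.
have {}H0 := H0 ltac:(rewrite ler_norml; lra).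
have {}H1 := H1 ltac:(rewrite ler_norml; lra).
have {}H2 := H2 ltac:(rewrite ler_norml; lra).
rewrite spline_sum2E.
set A := _ - _ in H0; set B := _ - _ in H1; set C := _ - _ in H2.
have E : Num.max 0 (u - `|x|) = (`|x + u| + `|x - u|) / 2 - `|x|.
  case: (ger0P x) => ?; case: (ger0P (x + u)) => ?; case: (ger0P (x - u)) => ?;
  by case: leP; lra.
rewrite (_ : _ - _ = - ((pi ^+ 2)^-1 * (A - B / 2 - C / 2))); last first.
  have pi0 : pi != 0 :> R by rewrite gt_eqF ?pi_gt0.
  by rewrite E /A /B /C; move: (@cos_sum R K pi) (pi : R) pi0 => c p p0; field.
rewrite normrN normrM ger0_norm ?invr_ge0 ?exprn_ge0//; last by lra.
have p1 : (pi ^+ 2)^-1 <= 1 :> R by rewrite invf_le1 ?exprn_gt0; nra.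
rewrite (le_trans (ler_wpM2r _ p1))// mul1r.
rewrite !(le_trans (ler_normB _ _))//.
rewrite (le_trans (lerD (ler_normB _ _) (lexx _)))// !normrM !(@ger0_norm _ 2^-1) ?invr_ge0//.
lra.
Qed.

(** * Splines and their partial Fourier sums *)

Lemma is_derive_continuous (R : realType) (f df : R -> R) :
  (forall x : R, is_derive x 1 f (df x)) -> continuous f.
Proof.
by move=> fdf x; apply/differentiable_continuous/derivable1_diffP; case: (fdf x).
Qed.

Lemma continuous_integrable_itvco (R : realType) (f : R -> R) (a b : R) :
  continuous f -> (@lebesgue_measure R).-integrable `[a, b[ (EFin \o f).
Proof.
move=> cf.
have H : (@lebesgue_measure R).-integrable `[a, b] (EFin \o f).
  apply: continuous_compact_integrable; first exact: segment_compact.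
  exact: continuous_subspaceT.
apply: integrableS H => //; exact: subset_itv_co_cc.
Qed.

Lemma Rintegral_FTC2 (R : realType) (f F : R -> R) (a b : R) : a < b ->
  continuous f -> (forall x : R, is_derive x 1 F (f x)) ->
  \int[@lebesgue_measure R]_(x in `[a, b[) f x = F b - F a.
Proof.
move=> ab cf dF; have cF := is_derive_continuous dF.
rewrite Rintegral_itv_bndo_bndc; last exact: continuous_integrable_itvco.
rewrite /Rintegral (@continuous_FTC2 _ f F)//.
- exact: continuous_subspaceT.
- split; [by move=> x _; case: (dF x)| |].
    by apply: cvg_at_right_filter; exact: cF.
  by apply: cvg_at_left_filter; exact: cF.
- by move=> x _; rewrite derive1E; case: (dF x).
Qed.

Lemma le_normr_Rintegral_itvco (R : realType) (f : R -> R) (M a b : R) : a <= b ->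
  continuous f -> (forall x, x \in `[a, b[ -> `|f x| <= M) ->
  `|\int[@lebesgue_measure R]_(x in `[a, b[) f x| <= M * (b - a).
Proof.
move=> ab cf fM.
have If := continuous_integrable_itvco a b cf.
rewrite (le_trans (le_normr_Rintegral _ If))//.
have cM : continuous (cst M : R -> R) by move=> x; exact: cvg_cst.
have cn : continuous (fun x => `|f x|).
  by move=> x; apply: cvg_norm; exact: cf.
rewrite (@le_trans _ _ (\int[@lebesgue_measure R]_(x in `[a, b[) M))//.
  apply: le_Rintegral => //.
  - exact: (continuous_integrable_itvco _ _ cn).
  - exact: (continuous_integrable_itvco _ _ cM).
rewrite Rintegral_cst//= lebesgue_measure_itv/= lte_fin.
by case: ltP => [//|ba]; rewrite /= mulr0 (le_anti (introT andP (conj ab ba))) subrr mulr0.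
Qed.

Lemma convolution_indicE (R : realType) (f : R -> R) (u x : R) :
  convolution f (indic_interval u) x =
  \int[@lebesgue_measure R]_(y in `[- (u / 2), u / 2[) f (x - y).
Proof.
rewrite [RHS]Rintegral_mkcond /convolution; congr (Rintegral _ _ _).
by apply/funext => y; rewrite patch_indic.
Qed.

Lemma continuous_reflect (R : realType) (f : R -> R) (s : R) :
  continuous f -> continuous (fun t => f (s - t)).
Proof.
move=> cf t; apply: (@continuous_comp _ _ _ (fun t => s - t) f); last exact: cf.
by apply: continuousB => //; exact: cvg_cst.
Qed.

(** One smoothing step multiplies a uniform distance by [u]. Taken with [f = g] it propagates
    Lipschitz bounds, with [x = z] approximation errors. *)
Lemma convolution_indic_dist (R : realType) (f g : R -> R) (u x z M : R) :
  continuous f -> continuous g -> 0 <= u ->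
  (forall y, y \in `[- (u / 2), u / 2[ -> `|f (x - y) - g (z - y)| <= M) ->
  `|convolution f (indic_interval u) x - convolution g (indic_interval u) z| <= u * M.
Proof.
move=> cf cg u0 fgM; rewrite !convolution_indicE.
have cf' := @continuous_reflect _ _ x cf; have cg' := @continuous_reflect _ _ z cg.
rewrite -RintegralB//; [|exact: (continuous_integrable_itvco _ _ cf')|
  exact: (continuous_integrable_itvco _ _ cg')].
have cfg : continuous (fun y => f (x - y) - g (z - y)).
  by move=> y; apply: continuousB; [exact: cf'|exact: cg'].
have ab : - (u / 2) <= u / 2 by lra.
rewrite (le_trans (le_normr_Rintegral_itvco ab cfg fgM))//.
by rewrite opprK -splitr mulrC.
Qed.

Lemma lipschitz_continuous (R : realType) (L : R) (f : R -> R) :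
  (forall x y, `|f x - f y| <= L * `|x - y|) -> continuous f.
Proof.
move=> fL x; apply/cvgrPdist_lt => e e0.
have L0 : 0 < `|L| + 1 by rewrite ltr_wpDl.
near=> y; rewrite (le_lt_trans (fL x y))//.
rewrite (@le_lt_trans _ _ ((`|L| + 1) * `|x - y|))//.
  by rewrite ler_wpM2r// (le_trans (ler_norm L))// lerDl.
rewrite mulrC -ltr_pdivlMr//; near: y.
by apply: cvgr_dist_lt => //; rewrite divr_gt0.
Unshelve. all: by end_near. Qed.

Lemma smooth1S (R : realType) (k : nat) (u : R) :
  smooth1 k.+2 u = convolution (smooth1 k.+1 u) (indic_interval u).
Proof. by []. Qed.

Lemma smooth1_2 (R : realType) (u x : R) : 0 < u ->
  smooth1 2 u x = Num.max 0 (u - `|x|).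
Proof.
move=> u0; rewrite smooth1S convolution_indicE /smooth1/= /indic_interval.
(* These are the [y] with [x - y] in [[- (u / 2), u / 2[]; reflection moves the open end to the
   left. *)
pose J : set R := `]x - u / 2, x + u / 2]%classic.
transitivity (\int[@lebesgue_measure R]_(y in `[- (u / 2), u / 2[) (\1_J y : R)).
  apply: eq_Rintegral => y _; rewrite !indicE; congr (_%:R); congr nat_of_bool.
  by apply/idP/idP; rewrite !inE /J/= !in_itv/=; lra.
rewrite /Rintegral integral_indic//=; last exact: measurable_itv.
have [x0|x0] := ger0P x.
  rewrite (_ : J `&` _ = `]x - u / 2, u / 2[%classic).
    rewrite lebesgue_measure_itv/= lte_fin.
    by case: ltP => ab; case: leP; rewrite /=; lra.
  by apply/seteqP; split => y; rewrite /J/= !in_itv/=; [case=> /andP[? ?] /andP[? ?]|]; lra.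
rewrite (_ : J `&` _ = `[- (u / 2), x + u / 2]%classic).
  rewrite lebesgue_measure_itv/= lte_fin.
  by case: ltP => ab; case: leP; rewrite /=; lra.
by apply/seteqP; split => y; rewrite /J/= !in_itv/=; lra.
Qed.

Lemma maxr0_dist (R : realType) (a b d : R) :
  `|a - b| <= d -> `|Num.max 0 a - Num.max 0 b| <= d.
Proof. by rewrite !ler_norml; case: (leP 0 a); case: (leP 0 b); lra. Qed.

(** The triangle, of order 2, has slope at most 1, and each further convolution contributes a factor
    [u]. *)
Lemma smooth1_lipschitz (R : realType) (k : nat) (u x y : R) : 0 < u ->
  `|smooth1 k.+2 u x - smooth1 k.+2 u y| <= u ^+ k * `|x - y|.
Proof.
move=> u0; elim: k x y => [|k IH] x y.
  rewrite !smooth1_2// expr0 mul1r.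
  apply: maxr0_dist; rewrite -normrN (le_trans _ (ler_dist_dist x y))//.
  by rewrite opprB addrC opprB addrA subrK.
have ch := lipschitz_continuous IH.
rewrite !(smooth1S k.+1) exprS -mulrA; apply: convolution_indic_dist => //.
  exact: ltW.
move=> z _; rewrite (le_trans (IH _ _))//.
by rewrite opprB addrA subrK.
Qed.

Lemma smooth1_continuous (R : realType) (k : nat) (u : R) : 0 < u ->
  continuous (smooth1 k.+2 u).
Proof. by move=> u0; apply: lipschitz_continuous => x y; exact: smooth1_lipschitz. Qed.

Lemma smooth1_ge0 (R : realType) (r : nat) (u x : R) : 0 <= smooth1 r u x.
Proof.
case: r => [|r]; first by rewrite /smooth1/= /indic_interval indicE.
elim: r x => [|r IH] x; first by rewrite /smooth1/= /indic_interval indicE.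
by rewrite smooth1S convolution_indicE; apply: Rintegral_ge0 => y _; exact: IH.
Qed.

(** From order 2 on, the end point [|x| = r u / 2] is included; this matters for boxes of side
    exactly 1. *)
Lemma smooth1_eq0 (R : realType) (k : nat) (u x : R) : 0 < u ->
  k.+2%:R * u / 2 <= `|x| -> smooth1 k.+2 u x = 0.
Proof.
move=> u0; elim: k x => [|k IH] x xu.
  by rewrite smooth1_2//; case: leP => //; lra.
rewrite smooth1S convolution_indicE.
transitivity (\int[@lebesgue_measure R]_(y in `[- (u / 2), u / 2[) (0 : R)); last first.
  by rewrite Rintegral_cst//= mul0r.
apply: eq_Rintegral => y; rewrite inE/= in_itv/= => /andP[y1 y2]; apply: IH.
have yu : `|y| <= u / 2 by rewrite ler_norml y1 ltW.
have := ler_normD (x - y) y; rewrite subrK.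
move: xu; rewrite -[k.+3%:R]natr1; set K := k.+2%:R.
move: yu; lra.
Qed.

Lemma spline_sum_continuous (R : realType) (r : nat) (u : R) (K : nat) :
  continuous (spline_sum r u K).
Proof.
pose c (k : 'I_K) : R := (sin (pi * k.+1%:R * u) / (pi * k.+1%:R)) ^+ r.
pose a (k : 'I_K) : R := 2 * pi * k.+1%:R.
have D (x : R) := is_deriveD (is_derive_cst (u ^+ r) x 1)
  (@is_deriveZ _ _ _ _ (2 : R) x 1 _ (is_derive_sum_cos c a x)).
exact: is_derive_continuous D.
Qed.

Definition spline_sum_primitive (R : realType) (r : nat) (u : R) (K : nat) (t : R) : R :=
  u ^+ r * t + 2 * \sum_(k < K)
    (sin (pi * k.+1%:R * u) / (pi * k.+1%:R)) ^+ r / (2 * pi * k.+1%:R)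
      * sin (2 * pi * k.+1%:R * t).

Lemma is_derive_spline_sum_primitive (R : realType) (r : nat) (u : R) (K : nat) (t : R) :
  is_derive t 1 (spline_sum_primitive r u K) (spline_sum r u K t).
Proof.
pose c (k : 'I_K) : R := (sin (pi * k.+1%:R * u) / (pi * k.+1%:R)) ^+ r.
pose a (k : 'I_K) : R := 2 * pi * k.+1%:R.
have := is_deriveD (is_derive_scale (u ^+ r) t)
  (@is_deriveZ _ _ _ _ (2 : R) t 1 _ (is_derive_sum_sin (fun k => c k / a k) a t)).
move=> H; apply: is_derive_eq H _; rewrite /spline_sum; congr (_ + _ * _).
apply: eq_bigr => k _; rewrite divfK// gt_eqF// !mulr_gt0//.
exact: pi_gt0.
Qed.

Lemma is_derive_reflect (R : realType) (F f : R -> R) (s t : R) :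
  (forall x : R, is_derive x 1 F (f x)) ->
  is_derive t 1 (fun t => - F (s - t)) (f (s - t)).
Proof.
move=> dF; have D := is_deriveB (is_derive_cst s t 1) (is_derive_id t 1).
have := is_deriveN (@is_derive1_comp _ F (cst s - id) t _ _ (dF (s - t)) D).
by move=> H; apply: is_derive_eq H _; rewrite sub0r mulrN mulr1 opprK.
Qed.

(** Convolving with the indicator multiplies the constant term by [u] and the [k]th cosine by
    [sin (pi k u) / (pi k)], the integral of [cos (2 pi k y)] over the interval. *)
Lemma convolution_spline_sum (R : realType) (r : nat) (u : R) (K : nat) (x : R) :
  0 < u ->
  convolution (spline_sum r u K) (indic_interval u) x = spline_sum r.+1 u K x.
Proof.
move=> u0; rewrite convolution_indicE.
have dG (y : R) := is_derive_reflect x y (is_derive_spline_sum_primitive r u K).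
rewrite (Rintegral_FTC2 _ _ dG); first last.
- exact/continuous_reflect/spline_sum_continuous.
- by lra.
rewrite /spline_sum_primitive /spline_sum opprK !opprD opprK.
rewrite addrACA; congr (_ + _); first by rewrite exprSr; field.
rewrite addrC -mulrN -mulrDr -sumrN -big_split/=; congr (_ * _); apply: eq_bigr => k _.
rewrite exprSr; move: (_ ^+ r) => c.
have := pi_gt0 R; set a := pi * k.+1%:R => pi0.
have a0 : a != 0 by rewrite gt_eqF// mulr_gt0.
have -> : 2 * pi * k.+1%:R = 2 * a by rewrite /a mulrA.
clearbody a.
have -> : 2 * a * (x + u / 2) = 2 * a * x + a * u by field.
have -> : 2 * a * (x - u / 2) = 2 * a * x - a * u by field.
by rewrite sinD sinB; field.
Qed.

(** Induction from the triangle: each convolution multiplies the error by [u] and narrows the range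
    of [x] by [u / 2]. *)
Lemma smooth1_spline_sum (R : realType) (k : nat) (u : R) (K : nat) (x : R) :
  (0 < K)%N -> 0 < u -> `|x| <= 1 - k.+2%:R * u / 2 ->
  `|smooth1 k.+2 u x - spline_sum k.+2 u K x| <= u ^+ k * (4 / K%:R).
Proof.
move=> K0 u0; elim: k x => [|k IH] x xu.
  by rewrite expr0 mul1r smooth1_2//; apply: triangle_spline_sum => //; lra.
rewrite smooth1S -convolution_spline_sum// exprS -mulrA.
apply: convolution_indic_dist; [exact: smooth1_continuous|exact: spline_sum_continuous
  |exact: ltW|].
move=> y; rewrite in_itv/= => /andP[y1 y2]; apply: IH.
have yu : `|y| <= u / 2 by rewrite ler_norml y1 ltW.
have := ler_normB x y.
move: xu; rewrite -[k.+3%:R]natr1; set N := k.+2%:R.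
move: yu; lra.
Qed.

(** * Periodization *)

Lemma cos_intmul_2pi (R : realType) (m : int) (t : R) :
  cos (m%:~R * (pi *+ 2) + t) = cos t.
Proof.
case: m => n; first exact: cos_natmul_2pi.
by rewrite NegzE mulrNz mulNr -[LHS](cos_natmul_2pi n.+1) addrA subrr add0r.
Qed.

Lemma spline_sum_periodic (R : realType) (r : nat) (u : R) (K : nat) (m : int) (x : R) :
  spline_sum r u K (m%:~R + x) = spline_sum r u K x.
Proof.
rewrite /spline_sum; congr (_ + _ * _); apply: eq_bigr => k _; congr (_ * _).
rewrite -[RHS](cos_intmul_2pi (k.+1%:Z * m)); congr cos.
by rewrite intrM; ring.
Qed.

(** The representative of [x] modulo 1 in [[-1/2, 1/2[]. *)
Definition recenter (R : realType) (x : R) : R := x - (Num.floor (x + 2^-1))%:~R.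

Lemma norm_recenter (R : realType) (x : R) : `|recenter x| <= 2^-1.
Proof.
have := floor_itv (x + 2^-1); rewrite intrD /recenter => /andP[h1 h2].
by rewrite ler_norml; lra.
Qed.

Lemma norm_int_ge1 (R : realType) (m : int) : m != 0 -> 1 <= `|m%:~R| :> R.
Proof. by move=> m0; rewrite -intr_norm -[1]/(1%:~R) ler_int; lia. Qed.

(** For [2 <= r] and [r u <= 1] this is the periodization of [smooth1 r u]: every other integer
    translate of [x] has absolute value at least [1/2] and lies outside the support. *)
Definition periodic_spline (R : realType) (r : nat) (u x : R) : R :=
  smooth1 r u (recenter x).

Lemma periodic_spline_sum (R : realType) (k : nat) (u : R) (K : nat) (x : R) :
  (0 < K)%N -> 0 < u -> k.+2%:R * u <= 1 ->
  `|periodic_spline k.+2 u x - spline_sum k.+2 u K x| <= u ^+ k * (4 / K%:R).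
Proof.
move=> K0 u0 ku; rewrite -(spline_sum_periodic _ _ _ (- Num.floor (x + 2^-1))).
rewrite mulrNz [_ + x]addrC; apply: smooth1_spline_sum => //.
by have := norm_recenter x; lra.
Qed.

Lemma smooth1_shift_eq0 (R : realType) (k : nat) (u x : R) (m : int) : 0 < u ->
  k.+2%:R * u <= 1 -> m != - Num.floor (x + 2^-1) -> smooth1 k.+2 u (m%:~R + x) = 0.
Proof.
move=> u0 ku mx; apply: smooth1_eq0 => //.
have : m + Num.floor (x + 2^-1) != 0 by rewrite addr_eq0.
move=> /(norm_int_ge1 R); rewrite intrD => h.
have := norm_recenter x; rewrite /recenter => h2.
have := ler_normB (m%:~R + x) (x - (Num.floor (x + 2^-1))%:~R).
rewrite (_ : _ - _ = m%:~R + (Num.floor (x + 2^-1))%:~R); last by ring.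
by lra.
Qed.

Lemma periodized_smooth_boxE (R : realType) (k : nat) (a u x : R * R) :
  0 < u.1 -> 0 < u.2 -> k.+2%:R * u.1 <= 1 -> k.+2%:R * u.2 <= 1 ->
  periodized_smooth_box k.+2 a u x =
  periodic_spline k.+2 u.1 (x.1 - a.1) * periodic_spline k.+2 u.2 (x.2 - a.2).
Proof.
move=> u10 u20 ku1 ku2; rewrite /periodized_smooth_box.
pose m0 := (- Num.floor (x.1 - a.1 + 2^-1), - Num.floor (x.2 - a.2 + 2^-1)).
rewrite -(@fsbig_widen _ _ _ _ [set m0])//.
  rewrite fsbig_set1 /smooth_box /periodic_spline /recenter /=.
  by rewrite !mulrNz -!addrA ![- _ + (_ - _)]addrC !addrA.
move=> [m1 m2] [_ /= /eqP m12]; rewrite /smooth_box/= -!addrA.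
have [m1E|m1E] := eqVneq m1 m0.1; last by rewrite (smooth1_shift_eq0 _ _ m1E)// mul0r.
have [m2E|m2E] := eqVneq m2 m0.2; last by rewrite (smooth1_shift_eq0 _ _ m2E)// mulr0.
by move: m12; rewrite m1E m2E eqxx.
Qed.

Lemma continuous_translate (R : realType) (f : R -> R) (s : R) :
  continuous f -> continuous (fun t => f (t - s)).
Proof.
move=> cf t; apply: (@continuous_comp _ _ _ (fun t => t - s) f); last exact: cf.
by apply: continuousB => //; exact: cvg_cst.
Qed.

(** A uniform limit of trigonometric sums; this avoids a separate look at the jumps of
    [recenter]. *)
Lemma periodic_spline_continuous (R : realType) (k : nat) (u : R) : 0 < u ->
  k.+2%:R * u <= 1 -> continuous (periodic_spline k.+2 u).
Proof.
move=> u0 ku x; apply/cvgrPdist_lt => e e0.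
have [K K0 Ke] : exists2 K, (0 < K)%N & u ^+ k * (4 / K%:R) < e / 3.
  pose M := u ^+ k * 4 / (e / 3).
  have M0 : 0 <= M by rewrite !mulr_ge0 ?invr_ge0 ?exprn_ge0 ?mulr_ge0 ?invr_ge0// ltW.
  exists (Num.bound M).+1 => //; rewrite mulrA ltr_pdivrMr ?ltr0n//.
  have : M < (Num.bound M).+1%:R by rewrite (lt_trans (archi_boundP M0))// ltr_nat.
  by rewrite {1}/M ltr_pdivrMr ?divr_gt0// [_%:R * _]mulrC.
near=> y.
have hx := periodic_spline_sum x K0 u0 ku.
have hy := periodic_spline_sum y K0 u0 ku.
have hxy : `|spline_sum k.+2 u K x - spline_sum k.+2 u K y| < e / 3.
  near: y; apply: cvgr_dist_lt; last by rewrite divr_gt0.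
  exact: spline_sum_continuous.
move: hx hy hxy; rewrite !ler_norml !ltr_norml; lra.
Unshelve. all: by end_near. Qed.

Lemma Rintegral_spline_sum (R : realType) (r : nat) (u : R) (K : nat) (s : R) :
  \int[@lebesgue_measure R]_(x in `[0, 1[) spline_sum r u K (x - s) = u ^+ r.
Proof.
transitivity (\int[@lebesgue_measure R]_(x in `[0, 1[) spline_sum r u K (s - x)).
  apply: eq_Rintegral => x _; rewrite /spline_sum; congr (_ + _ * _).
  by apply: eq_bigr => k _; rewrite -cosN -mulrN opprB.
have dG (y : R) := is_derive_reflect s y (is_derive_spline_sum_primitive r u K).
rewrite (Rintegral_FTC2 _ _ dG)//; last first.
  exact/continuous_reflect/spline_sum_continuous.
rewrite opprK addrC subr0 /spline_sum_primitive.
rewrite (_ : \sum_(k < K) _ = \sum_(k < K) (sin (pi * k.+1%:R * u) / (pi * k.+1%:R)) ^+ r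
  / (2 * pi * k.+1%:R) * sin (2 * pi * k.+1%:R * (s - 1))); first by ring.
apply: eq_bigr => k _; congr (_ * _).
rewrite -!cosBpihalf -[RHS](cos_natmul_2pi k.+1); congr cos; ring.
Qed.

Lemma Rintegral_periodic_spline (R : realType) (k : nat) (u s : R) : 0 < u ->
  k.+2%:R * u <= 1 ->
  \int[@lebesgue_measure R]_(x in `[0, 1[) periodic_spline k.+2 u (x - s) = u ^+ k.+2.
Proof.
move=> u0 ku; apply/eqP; rewrite -subr_eq0 -normr_le0.
apply: (@norm_le_div_nat _ _ _ (u ^+ k * 4) 1) => //; last by rewrite mulr_ge0 ?exprn_ge0 ?ltW.
move=> N; rewrite add0r natr1.
have c1 := @continuous_translate _ _ s (@periodic_spline_continuous _ k u u0 ku).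
have c2 := @continuous_translate _ _ s (@spline_sum_continuous R k.+2 u N.+1).
rewrite -(Rintegral_spline_sum k.+2 u N.+1 s).
rewrite -RintegralB//; [|exact: (continuous_integrable_itvco _ _ c1)
  |exact: (continuous_integrable_itvco _ _ c2)].
have c12 : continuous (fun x : R => periodic_spline k.+2 u (x - s) -
    spline_sum k.+2 u N.+1 (x - s)).
  by move=> x; exact: (continuousB (c1 x) (c2 x)).
have B (x : R) : x \in `[0, 1[ -> `|periodic_spline k.+2 u (x - s) -
    spline_sum k.+2 u N.+1 (x - s)| <= u ^+ k * (4 / N.+1%:R).
  by move=> _; exact: periodic_spline_sum.
have := le_normr_Rintegral_itvco ler01 c12 B.
by rewrite subr0 mulr1 mulrA.
Qed.

(** Tonelli's theorem, applied to the extensions of [f] and [g] by zero outside [[0, 1[]. *)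
Lemma Rintegral_unit_square_prod (R : realType) (f g : R -> R) :
  continuous f -> continuous g -> (forall x, 0 <= f x) -> (forall x, 0 <= g x) ->
  \int[@lebesgue2 R]_(x in @unit_square R) (f x.1 * g x.2) =
  \int[@lebesgue_measure R]_(x in `[0, 1[) f x *
  \int[@lebesgue_measure R]_(x in `[0, 1[) g x.
Proof.
move=> cf cg f0 g0.
pose I : set R := `[0, 1[%classic.
have mI : measurable (I : set (measurableTypeR R)) by exact: measurable_itv.
pose f' : measurableTypeR R -> R := f \_ I.
pose g' : measurableTypeR R -> R := g \_ I.
have mf' : measurable_fun setT f'.
  by apply/(measurable_restrictT f mI)/measurable_funTS; exact: continuous_measurable_fun.
have mg' : measurable_fun setT g'.
  by apply/(measurable_restrictT g mI)/measurable_funTS; exact: continuous_measurable_fun.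
have f'0 x : 0 <= f' x by rewrite /f' patchE; case: ifP.
have g'0 x : 0 <= g' x by rewrite /g' patchE; case: ifP.
have if' : (@lebesgue_measure R).-integrable `[0, 1[ (EFin \o f).
  exact: continuous_integrable_itvco.
have ig' : (@lebesgue_measure R).-integrable `[0, 1[ (EFin \o g).
  exact: continuous_integrable_itvco.
have E : (\int[@lebesgue2 R]_(x in @unit_square R) (f x.1 * g x.2)%:E =
   \int[@lebesgue_measure R]_(x in I) (f x)%:E *
   \int[@lebesgue_measure R]_(x in I) (g x)%:E)%E.
  rewrite integral_mkcond.
  rewrite (_ : _ \_ _ = (fun x => (f' x.1 * g' x.2)%:E)); last first.
    apply/funext => -[x y]; rewrite /f' /g' !patchE/=.
    have -> : ((x, y) \in @unit_square R) = (x \in I) && (y \in I).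
      by apply/idP/andP; rewrite !inE.
    by case: (x \in I); case: (y \in I); rewrite ?mulr0 ?mul0r.
  have mfg : measurable_fun [set: measurableTypeR R * measurableTypeR R]
      (fun x => (f' x.1 * g' x.2)%:E).
    apply/measurable_EFinP; apply: measurable_funM; first exact: measurableT_comp.
    exact: measurableT_comp.
  rewrite /lebesgue2/= fubini_tonelli1//; last by move=> x; rewrite lee_fin mulr_ge0.
  rewrite /fubini_F/=.
  have Ig : (\int[@lebesgue_measure R]_y (g' y)%:E = 
    \int[@lebesgue_measure R]_(x in I) (g x)%:E)%E.
    by rewrite [RHS]integral_mkcond; apply: eq_integral => y _; rewrite restrict_EFin.
  have If : (\int[@lebesgue_measure R]_y (f' y)%:E = 
    \int[@lebesgue_measure R]_(x in I) (f x)%:E)%E.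
    by rewrite [RHS]integral_mkcond; apply: eq_integral => y _; rewrite restrict_EFin.
  under eq_integral => x _.
    under eq_integral do rewrite EFinM.
    rewrite ge0_integralZl//; [over| | |]; last 2 first.
    - by move=> y _; rewrite lee_fin.
    - by rewrite lee_fin.
    - exact/measurable_EFinP.
  rewrite /= Ig ge0_integralZr//.
  - by rewrite If.
  - exact/measurable_EFinP.
  - by move=> x _; rewrite lee_fin.
  - by apply: integral_ge0 => x _; rewrite lee_fin.
by rewrite /Rintegral E fineM//; exact: integrable_fin_num.
Qed.

(** * Averages over the Fibonacci lattice *)

Lemma sin_intmul_2pi (R : realType) (m : int) (t : R) :
  sin (m%:~R * (pi *+ 2) + t) = sin t.
Proof. by rewrite -!cosBpihalf -addrA cos_intmul_2pi. Qed.

(** One may reduce [q] modulo [b]. For a remainder [0 < m < b], multiplication by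
    [2 sin (pi m / b)], which is nonzero, telescopes the sum, and the two ends differ by full
    turns. *)
Lemma sum_cos_arithmetic (R : realType) (b : nat) (q : int) (c : R) : (0 < b)%N ->
  `|\sum_(i < b) cos (2 * pi * (i.+1%:R * q%:~R / b%:R) - c)| <=
  b%:R * (b %| q)%Z%:R.
Proof.
move=> b0; have br0 : 0 < b%:R :> R by rewrite ltr0n.
set m := (q %% b)%Z; pose d := (q %/ b)%Z.
have qE : q%:~R = d%:~R * b%:R + m%:~R :> R.
  by rewrite {1}(divz_eq q b) intrD intrM.
have m0 : 0 <= m by rewrite modz_ge0// -lt0n.
have mb : m < b by rewrite ltz_pmod.
have -> : \sum_(i < b) cos (2 * pi * (i.+1%:R * q%:~R / b%:R) - c) =
    \sum_(i < b) cos (2 * pi * (i.+1%:R * m%:~R / b%:R) - c).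
  apply: eq_bigr => i _; rewrite -[RHS](cos_intmul_2pi (i.+1%:Z * d)); congr cos.
  rewrite qE intrM; move: (pi : R) => p; field.
  by rewrite gt_eqF.
have [bq|bq] := boolP (b %| q)%Z.
  rewrite mulr1 (le_trans (ler_norm_sum _ _ _))// -[X in _ <= X%:R](card_ord b).
  by rewrite -sumr_const; apply: ler_sum => i _; exact: cos_max.
rewrite mulr0 normr_le0; have mn0 : 0 < m.
  rewrite lt_neqAle m0 andbT eq_sym; apply: contra bq => /eqP mE.
  by apply/dvdz_mod0P.
set a : R := pi * m%:~R / b%:R.
have s0 : 0 < sin a.
  apply: sin_gt0_pi; rewrite /a divr_gt0 ?mulr_gt0 ?pi_gt0 ?ltr0z//=.
  by rewrite ltr_pdivrMr// ltr_pM2l ?pi_gt0// -[b%:R]/(b%:~R) ltr_int.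
have tele (N : nat) : 2 * sin a * \sum_(i < N) cos (2 * pi * (i.+1%:R * m%:~R / b%:R) - c)
    = sin (a *+ 2 * N%:R + a - c) - sin (a - c).
  elim: N => [|N IH]; first by rewrite big_ord0 !mulr0 add0r subrr.
  rewrite big_ord_recr/= mulrDr IH.
  have -> : a *+ 2 * N%:R + a - c = (2 * pi * (N.+1%:R * m%:~R / b%:R) - c) - a.
    by rewrite /a; move: (pi : R) => p; field; rewrite gt_eqF.
  have -> : a *+ 2 * N.+1%:R + a - c = (2 * pi * (N.+1%:R * m%:~R / b%:R) - c) + a.
    by rewrite /a; move: (pi : R) => p; field; rewrite gt_eqF.
  by move: (2 * pi * _ - c) (sin (a - c)) => y z; rewrite sinB sinD; ring.
have := tele b; rewrite (_ : _ + a - c = m%:~R * (pi *+ 2) + (a - c)); last first.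
  by rewrite /a; move: (pi : R) => p; field; rewrite gt_eqF.
rewrite sin_intmul_2pi subrr => /eqP.
by rewrite mulf_eq0 mulf_eq0 pnatr_eq0/= (gt_eqF s0).
Qed.

Lemma cos_fracpart (R : realType) (k : nat) (x s : R) :
  cos (2 * pi * k%:R * (fracpart x - s)) = cos (2 * pi * k%:R * (x - s)).
Proof.
rewrite -[LHS](cos_intmul_2pi (k%:Z * Num.floor x)); congr cos.
by rewrite /fracpart intrM; ring.
Qed.

(* For [q = 1] or [q = - 1]: the frequency [(k, q l)] is in the dual lattice. *)
Definition fibonacci_dual (n : nat) (q : int) (k l : nat) : bool :=
  (fib n %| k%:Z + q * ((fib n.-1)%:Z * l%:Z))%Z.

(** The product of cosines splits into the frequencies [k + b_{n-1} l] and [k - b_{n-1} l], whence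
    the two signs [q]. Fractional parts drop out because [k] and [l] are integers. *)
Lemma fibonacci_average_cos (R : realType) (n k l : nat) (s t : R) :
  `|(fib n)%:R^-1 * \sum_(i < fib n)
      (cos (2 * pi * k%:R * ((fibonacci_points R i).1 - s)) *
       cos (2 * pi * l%:R * ((fibonacci_points R i).2 - t)))| <=
  ((fibonacci_dual n 1 k l)%:R + (fibonacci_dual n (- 1) k l)%:R) / 2.
Proof.
have b0 : 0 < (fib n)%:R :> R by rewrite ltr0n fib_gt0.
pose c1 := 2 * pi * (k%:R * s + l%:R * t).
pose c2 := 2 * pi * (k%:R * s - l%:R * t).
pose q1 := k%:Z + 1 * ((fib n.-1)%:Z * l%:Z).
pose q2 := k%:Z + (- 1) * ((fib n.-1)%:Z * l%:Z).
have H1 := @sum_cos_arithmetic R (fib n) q1 c1 (fib_gt0 n).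
have H2 := @sum_cos_arithmetic R (fib n) q2 c2 (fib_gt0 n).
rewrite (_ : \sum_(i < _) _ =
   (\sum_(i < fib n) cos (2 * pi * (i.+1%:R * q1%:~R / (fib n)%:R) - c1) +
    \sum_(i < fib n) cos (2 * pi * (i.+1%:R * q2%:~R / (fib n)%:R) - c2)) / 2); last first.
  rewrite -big_split/= mulr_suml; apply: eq_bigr => i _.
  rewrite !cos_fracpart.
  set A := 2 * pi * k%:R * _; set B := 2 * pi * l%:R * _.
  have -> : 2 * pi * (i.+1%:R * q1%:~R / (fib n)%:R) - c1 = A + B.
    rewrite /q1 /c1 /A /B intrD !intrM/=; move: (pi : R) => p; field.
    by rewrite gt_eqF.
  have -> : 2 * pi * (i.+1%:R * q2%:~R / (fib n)%:R) - c2 = A - B.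
    rewrite /q2 /c2 /A /B intrD !intrM/=; move: (pi : R) => p; field.
    by rewrite gt_eqF.
  by rewrite cosD cosB; field.
move: H1 H2; rewrite -/(fibonacci_dual n 1 k l) -/(fibonacci_dual n (- 1) k l).
move: (\sum_(i < _) _) (\sum_(i < _) _) => S1 S2 H1 H2.
rewrite mulrA normrM [X in _ * X]ger0_norm ?invr_ge0// ler_pM2r ?invr_gt0//.
rewrite normrM ger0_norm ?invr_ge0 ?(ltW b0)// ler_pdivrMl// mulrDr.
by rewrite (le_trans (ler_normD _ _))// lerD.
Qed.

Lemma sin_le_id (R : realType) (x : R) : 0 <= x -> `|sin x| <= x.
Proof.
move=> x0.
have D (y : R) : y \in `[0, x] -> is_derive y 1 sin (cos y).
  by move=> _; exact: is_derive_sin.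
have B (y : R) : y \in `[0, x] -> `|cos y| <= 1 by move=> _; exact: cos_max.
by have := mean_value_bound x0 D B; rewrite sin0 !subr0 mul1r.
Qed.

(** The factor 2 merges the frequencies [k] and [-k]. *)
Definition spline_coef (R : realType) (r : nat) (u : R) (k : nat) : R :=
  if k is k'.+1 then 2 * (sin (pi * k'.+1%:R * u) / (pi * k'.+1%:R)) ^+ r
  else u ^+ r.

Lemma spline_sumE (R : realType) (r : nat) (u : R) (K : nat) (x : R) :
  spline_sum r u K x =
  \sum_(k < K.+1) spline_coef r u k * cos (2 * pi * k%:R * x).
Proof.
rewrite big_ord_recl /= mulr0 mul0r cos0 mulr1; congr (_ + _).
by rewrite mulr_sumr; apply: eq_bigr => k _; rewrite mulrA.
Qed.

(* [min(u, 1/k)^r], written so that [k = 0] needs no special case. *)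
Definition spline_weight (R : realType) (r : nat) (u : R) (k : nat) : R :=
  (Num.max u^-1 k%:R) ^- r.

Lemma spline_weight_ge0 (R : realType) (r : nat) (u : R) (k : nat) : 0 < u ->
  0 <= spline_weight r u k.
Proof. by move=> u0; rewrite invr_ge0 exprn_ge0// le_max invr_ge0 ltW. Qed.

Lemma spline_coef_le (R : realType) (r : nat) (u : R) (k : nat) : 0 < u ->
  `|spline_coef r u k| <= 2 * spline_weight r u k.
Proof.
move=> u0; rewrite /spline_weight -exprVn; case: k => [|k] /=.
  rewrite normrX (gtr0_norm u0) max_l ?invr_ge0 ?(ltW u0)// invrK.
  by rewrite mulr_natl mulr2n lerDl exprn_ge0// ltW.
have k0 : 0 < k.+1%:R :> R by rewrite ltr0n.
have p0 := pi_gt0 R; have p2 := pi_ge2 R.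
have pk : 0 < pi * k.+1%:R :> R by rewrite mulr_gt0.
rewrite normrM ger0_norm// ler_pM2l// normrX.
apply: lerXn2r; rewrite ?nnegrE// ?invr_ge0 ?le_max ?invr_ge0 ?(ltW u0)//.
rewrite normrM normfV (gtr0_norm pk) ler_pdivrMr//.
have m0 : 0 < Num.max u^-1 k.+1%:R by rewrite lt_max k0 orbT.
rewrite ler_pdivlMl//; case: (leP u^-1) => h.
  by rewrite (le_trans (ler_wpM2l _ (sin_max _)))// mulr1 ler_peMl//; lra.
rewrite ler_pdivrMl// mulrC; apply: sin_le_id.
by rewrite mulr_ge0// ltW.
Qed.

(** The frequency [(0, 0)] reproduces the exact integral and cancels. The others are bounded term by
    term; the factor 2 is [2 * 2] from the coefficients times [1 / 2] from the average. *)
Lemma quadrature_spline_sum (R : realType) (n r K : nat) (u1 u2 s t : R) :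
  0 < u1 -> 0 < u2 ->
  `|u1 ^+ r * u2 ^+ r - (fib n)%:R^-1 * \sum_(i < fib n)
     (spline_sum r u1 K ((fibonacci_points R i).1 - s) *
      spline_sum r u2 K ((fibonacci_points R i).2 - t))| <=
  2 * \sum_(p : 'I_K.+1 * 'I_K.+1 | p != (ord0, ord0))
    spline_weight r u1 p.1 * spline_weight r u2 p.2 *
    ((fibonacci_dual n 1 p.1 p.2)%:R + (fibonacci_dual n (- 1) p.1 p.2)%:R).
Proof.
move=> u10 u20.
have b0 : 0 < (fib n)%:R :> R by rewrite ltr0n fib_gt0.
pose avg (p : 'I_K.+1 * 'I_K.+1) : R := (fib n)%:R^-1 * \sum_(i < fib n)
      (cos (2 * pi * p.1%:R * ((fibonacci_points R i).1 - s)) *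
       cos (2 * pi * p.2%:R * ((fibonacci_points R i).2 - t))).
have -> : (fib n)%:R^-1 * \sum_(i < fib n)
     (spline_sum r u1 K ((fibonacci_points R i).1 - s) *
      spline_sum r u2 K ((fibonacci_points R i).2 - t)) =
   \sum_(p : 'I_K.+1 * 'I_K.+1) spline_coef r u1 p.1 * spline_coef r u2 p.2 * avg p.
  under eq_bigr => i _ do rewrite !spline_sumE big_distrlr/= pair_bigA/=.
  rewrite exchange_big/= mulr_sumr; apply: eq_bigr => p _.
  rewrite /avg [RHS]mulrCA; congr (_ * _); rewrite mulr_sumr.
  by apply: eq_bigr => i _; rewrite mulrACA.
rewrite (bigD1 (ord0, ord0))//=.
have -> : avg (ord0, ord0) = 1.
  rewrite /avg/=; under eq_bigr do rewrite mulr0 !mul0r cos0 mulr1.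
  by rewrite sumr_const card_ord -[_ *+ _]/((fib n)%:R) mulVf// gt_eqF.
rewrite mulr1 opprD addrA subrr sub0r normrN mulr_sumr.
rewrite (le_trans (ler_norm_sum _ _ _))//; apply: ler_sum => p _.
have h1 := spline_coef_le r p.1 u10; have h2 := spline_coef_le r p.2 u20.
have h3 := fibonacci_average_cos n p.1 p.2 s t.
rewrite normrM [X in X * _]normrM.
apply: (le_trans (ler_pM _ _ (ler_pM _ _ h1 h2) h3)); rewrite ?mulr_ge0//.
set w1 := spline_weight _ _ _; set w2 := spline_weight _ _ _.
by set d := _ + _; rewrite le_eqVlt; apply/orP; left; apply/eqP; field.
Qed.

(** * The dual lattice *)

(** Cassini's identity: [x^2 - x y - y^2] changes sign under [(x, y) -> (x + y, x)]. *)
Lemma fib_cassini (n : nat) :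
  (fib n.+1)%:Z ^+ 2 - (fib n.+1)%:Z * (fib n)%:Z - (fib n)%:Z ^+ 2 = (-1) ^+ n.+1.
Proof.
elim: n => [//|n IH]; rewrite [RHS]exprS -IH.
have -> : fib n.+2 = (fib n.+1 + fib n)%N by [].
by rewrite PoszD; ring.
Qed.

(* [4 (x^2 - x y - y^2) = (2 x - y)^2 - 5 y^2], and 5 divides a square to an even power. *)
Lemma golden_norm_neq0 (x y : int) : x ^+ 2 - x * y - y ^+ 2 = 0 -> x = 0 /\ y = 0.
Proof.
move=> H; have [y0|y0] := eqVneq y 0.
  by move: H; rewrite y0 mulr0 expr0n !subr0 => /eqP; rewrite expf_eq0 /= => /eqP.
have E : (2 * x - y) ^+ 2 = 5 * y ^+ 2.
  by apply/eqP; rewrite -subr_eq0 -(mulr0 4) -H; apply/eqP; ring.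
have := congr1 (fun z => logn 5 `|z|%N) E.
rewrite abszM !abszX lognM ?expn_gt0 ?absz_gt0 ?y0// !lognX.
have -> : logn 5 `|5 : int| = 1%N by [].
by move=> /(congr1 odd); rewrite oddD !oddM.
Qed.

Lemma fib_le (n : nat) : (fib n.-1 <= fib n)%N.
Proof. by case: n => [//|[//|n]] /=; rewrite leq_addr. Qed.

(** With [b m = d1 + b' k2], the value [Q] of the norm form at [(k2, m)] is a nonzero integer, so
    [b^2 <= |b^2 Q|]. Expanding [b^2 Q] in [d1] and [k2] gives the right-hand side, with
    [b + 2 b' <= 3 b] in the cross term. *)
Lemma fib_dual_hyperbolic (n : nat) (q d1 d2 : int) : (1 <= n)%N -> `|q| = 1 ->
  (d1, d2) != (0, 0) -> (fib n %| d1 + q * ((fib n.-1)%:Z * d2))%Z ->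
  (fib n)%:Z ^+ 2 <= d1 ^+ 2 + d2 ^+ 2 + 3 * (fib n)%:Z * (`|d1| * `|d2|).
Proof.
have aux (x y : nat) : (y <= x)%N -> `|x%:Z + 2 * y%:Z| <= 3 * x%:Z.
  by move=> yx; rewrite ger0_norm; lia.
case: n => // n _ q1 d0 /dvdzP [m E].
have := fib_cassini n; have := fib_le n.+1; have := fib_gt0 n.+1; rewrite -pred_Sn.
set b := fib n.+1; set b' := fib n; move=> b0 bb' cassini.
(* Eliminating [m] from [b^2 Q] turns the coefficient of [k2^2] into Cassini's +-1. *)
pose k2 := q * d2; pose Q := k2 ^+ 2 - k2 * m - m ^+ 2.
have nk2 : `|k2| = `|d2| by rewrite normrM q1 mul1r.
have k22 : k2 ^+ 2 = d2 ^+ 2 by rewrite -(real_normK (num_real k2)) nk2 real_normK ?num_real.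
have bm : b%:Z * m = d1 + b'%:Z * k2.
  by rewrite mulrC -E /k2 -pred_Sn -/b'; ring.
have QE : b%:Z ^+ 2 * Q = k2 ^+ 2 * (-1) ^+ n.+1 - d1 * k2 * (b%:Z + 2 * b'%:Z) - d1 ^+ 2.
  rewrite -cassini (_ : b%:Z ^+ 2 * Q =
    (b%:Z * k2) ^+ 2 - (b%:Z * k2) * (b%:Z * m) - (b%:Z * m) ^+ 2); last by rewrite /Q; ring.
  by rewrite bm; ring.
have Q0 : Q != 0.
  apply: contra d0 => /eqP /golden_norm_neq0 [k20 m0].
  move: bm; rewrite k20 m0 !mulr0 addr0 => <-.
  by move: nk2; rewrite k20 normr0 => /esym/eqP; rewrite normr_eq0 => /eqP ->.
have Q1 : 1 <= `|Q| by rewrite -gtz0_ge1 normr_gt0.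
have -> : d2 ^+ 2 = `|k2 ^+ 2 * (-1) ^+ n.+1|.
  by rewrite normrM !normrX normrN1 expr1n mulr1 nk2 real_normK ?num_real.
apply: (@le_trans _ _ `|b%:Z ^+ 2 * Q|).
  by rewrite normrM ger0_norm ?exprn_ge0// ler_peMr// exprn_ge0.
have hA : `|d1 * k2 * (b%:Z + 2 * b'%:Z)| <= 3 * b%:Z * (`|d1| * `|d2|).
  by rewrite !normrM q1 mul1r mulrC ler_wpM2r ?mulr_ge0// aux.
rewrite QE; apply: (le_trans (ler_normB _ _)).
rewrite normrX real_normK ?num_real// addrC -addrA lerD2l.
by apply: (le_trans (ler_normB _ _)); rewrite lerD2l.
Qed.

(** The difference of the two points is a nonzero dual point. If its second coordinate were below
    [b / (6 X)], the three terms of [fib_dual_hyperbolic] would be at most [b^2 / 4], [b^2 / 36] and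
    [b^2 / 2], less than [b^2] in total. *)
Lemma fibonacci_dual_separated (R : realType) (n : nat) (q : int) (k l k' l' : nat) (X : R) :
  (1 <= n)%N -> `|q| = 1 -> fibonacci_dual n q k l -> fibonacci_dual n q k' l' ->
  (k, l) != (k', l') -> `|k%:R - k'%:R| <= X -> 1 <= X -> X <= (fib n)%:R / 2 ->
  (fib n)%:R / (6 * X) <= `|l%:R - l'%:R|.
Proof.
move=> n1 q1 D D' kl kX X1 Xb.
have b0 : 0 < (fib n)%:R :> R by rewrite ltr0n fib_gt0.
have H := @fib_dual_hyperbolic n q (k%:Z - k'%:Z) (l%:Z - l'%:Z) n1 q1.
have {}H := H ltac:(by apply: contra kl => /eqP[/eqP + /eqP +];
  rewrite !subr_eq0 => /eqP[->] /eqP[->]).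
have {}H : ((fib n)%:R ^+ 2 <= (k%:R - k'%:R) ^+ 2 + (l%:R - l'%:R) ^+ 2
   + 3 * (fib n)%:R * (`|k%:R - k'%:R| * `|l%:R - l'%:R|) :> R).
  have {}H := H ltac:(rewrite (_ : _ + _ = (k%:Z + q * ((fib n.-1)%:Z * l%:Z)) -
    (k'%:Z + q * ((fib n.-1)%:Z * l'%:Z))); [exact: rpredB|by ring]).
  move: H; rewrite -(ler_int R) !(intrD, intrM, rmorphXn, rmorphN) /= !intr_norm !rmorphB//.
move: H; rewrite -(real_normK (num_real (k%:R - k'%:R))) -(real_normK (num_real (l%:R - l'%:R))).
have := normr_ge0 (l%:R - l'%:R : R); have := normr_ge0 (k%:R - k'%:R : R).
move: kX; move: (`|k%:R - _|) (`|l%:R - _|) ((fib n)%:R) b0 Xb => x y b b0 Xb xX x0 y0 H.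
rewrite leNgt; apply/negP => yb; move: H; apply/negP; rewrite -ltNge.
move: yb; rewrite ltr_pdivlMr ?mulr_gt0//; last by lra.
move=> yb.
have h1 : x * y <= X * y by rewrite ler_wpM2r.
have h2 : y <= y * X by rewrite ler_peMr.
have h3 : x ^+ 2 <= (b / 2) ^+ 2 by rewrite lerXn2r// ?nnegrE//; lra.
have h4 : y ^+ 2 <= (b / 6) ^+ 2 by rewrite lerXn2r// ?nnegrE//; lra.
nra.
Qed.

(** * Sums over the dual lattice *)

(* The map [t |-> floor (y t / d)] is injective on [P]. *)
Lemma sum_separated_le (R : realType) (T : finType) (P : pred T) (y F : T -> R)
    (g : nat -> R) (d B : R) : 0 < d ->
  (forall t, P t -> 0 <= y t) ->
  (forall s t, P s -> P t -> s != t -> d <= `|y s - y t|) ->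
  (forall t i, P t -> i%:R * d <= y t -> y t < i.+1%:R * d -> F t <= g i) ->
  (forall i, 0 <= g i) -> (forall N, \sum_(i < N) g i <= B) ->
  \sum_(t | P t) F t <= B.
Proof.
move=> d0 y0 sep Fg g0 gB.
pose f t := Num.truncn (y t / d).
have fitv t : P t -> (f t)%:R * d <= y t /\ y t < (f t).+1%:R * d.
  move=> Pt; have := @truncn_itv _ (y t / d).
  rewrite divr_ge0 ?y0 ?(ltW d0)// => /(_ isT) /andP[h1 h2].
  by rewrite -ler_pdivlMr// -ltr_pdivrMr.
have finj s t : P s -> P t -> f s = f t -> s = t.
  move=> Ps Pt fst; apply/eqP/contraT => st.
  have h := sep _ _ Ps Pt st; have [s1 s2] := fitv _ Ps; have [t1 t2] := fitv _ Pt.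
  move: s1 s2; rewrite fst -natr1 in t2 *; move: t1 t2; set i := (f t)%:R.
  rewrite mulrDl mul1r => t1 t2 s1 s2.
  suff : `|y s - y t| < d by rewrite ltNge h.
  by rewrite ltr_norml; lra.
pose N := (\max_(t | P t) f t).+1.
have fN t : P t -> (f t < N)%N by move=> Pt; rewrite ltnS (leq_bigmax_cond _ Pt).
apply: le_trans (gB N).
apply: (@le_trans _ _ (\sum_(t | P t) g (@inord N.-1 (f t)))).
  apply: ler_sum => t Pt; have [h1 h2] := fitv _ Pt.
  by rewrite inordK ?fN//; exact: Fg.
rewrite -(big_imset (fun i : 'I_N => g i) (A := P) (h := fun t => @inord N.-1 (f t)))/=; last first.
  move=> s t Ps Pt /(congr1 val); rewrite /= !inordK ?fN//; exact: finj.
by rewrite big_mkcond; apply: ler_sum => i _; case: ifP.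
Qed.

(** The term [i = 0] vanishes, as the inverse of 0 is 0. The others are compared with squares, for
    which [2 - 1 / (M + 1)] is an inductive bound. *)
Lemma sum_inv_pow (R : realType) (r N : nat) : (2 <= r)%N ->
  \sum_(i < N) (i%:R : R) ^- r <= 2.
Proof.
move=> r2.
have H M : \sum_(i < M.+2) (i%:R : R) ^- 2 <= 2 - M.+1%:R^-1.
  elim: M => [|M IH].
    by rewrite !big_ord_recr big_ord0/= expr0n/= invr0 expr1n invr1 !add0r; lra.
  rewrite big_ord_recr/=; apply: le_trans (lerD IH (lexx _)) _.
  rewrite -[M.+2%:R]natr1; have : 0 < M.+1%:R :> R by rewrite ltr0n.
  move: (M.+1%:R) => x x0; rewrite -subr_ge0.
  rewrite (_ : _ - _ = (x * (x + 1) ^+ 2)^-1); last by field; rewrite !gt_eqF//; lra.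
  by rewrite invr_ge0 mulr_ge0 ?exprn_ge0 ?addr_ge0// ltW.
apply: (@le_trans _ _ (\sum_(i < N.+2) (i%:R : R) ^- 2)); last first.
  by rewrite (le_trans (H N))// gerBl invr_ge0.
rewrite !big_ord_recr/= -addrA.
apply: ler_wpDr; first by rewrite addr_ge0// invr_ge0 exprn_ge0.
apply: ler_sum => i _; case: (nat_of_ord i) => [|j].
  by rewrite expr0n (gtn_eqF (leq_trans _ r2))// invr0 invr_ge0 exprn_ge0.
rewrite lef_pV2 ?posrE ?exprn_gt0 ?ltr0n// ler_weXn2l// ler1n//.
Qed.

Lemma fibonacci_dual0 (n : nat) (q : int) : fibonacci_dual n q 0 0.
Proof. by rewrite /fibonacci_dual !mulr0 addr0 dvdz0. Qed.

Lemma ord_pair_neq (K : nat) (s t : 'I_K * 'I_K) :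
  s != t -> (s.1 : nat, s.2 : nat) != (t.1 : nat, t.2 : nat).
Proof.
apply: contra => /eqP[] /val_inj h1 /val_inj h2.
by rewrite (surjective_pairing s) h1 h2 -surjective_pairing.
Qed.

(** Second coordinates in the strip lie in distinct cells of length [d = b / (6 X)], so the sum is
    at most that of [(i d)^-r]. *)
Lemma spline_weight_sum_near (R : realType) (n r K : nat) (q : int) (u X : R) :
  (1 <= n)%N -> (2 <= r)%N -> `|q| = 1 -> 0 < u -> 1 <= X -> X <= (fib n)%:R / 2 ->
  \sum_(p : 'I_K.+1 * 'I_K.+1 | [&& p != (ord0, ord0), fibonacci_dual n q p.1 p.2
      & p.1%:R < X]) spline_weight r u p.2 <= 2 * (6 * X / (fib n)%:R) ^+ r.
Proof.
move=> n1 r2 q1 u0 X1 Xb; set b : R := (fib n)%:R.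
have b0 : 0 < b by rewrite ltr0n fib_gt0.
pose d := b / (6 * X).
have d0 : 0 < d by rewrite divr_gt0 ?mulr_gt0//; lra.
apply: (@sum_separated_le _ _ _ (fun p : 'I_K.+1 * 'I_K.+1 => p.2%:R) _
  (fun i => (i%:R * d) ^- r) d) => //.
- move=> s t /and3P[_ sD sX] /and3P[_ tD tX] /ord_pair_neq st.
  apply: (fibonacci_dual_separated n1 q1 sD tD st _ X1 Xb).
  by rewrite ler_norml; have := ler0n R s.1; have := ler0n R t.1; lra.
- move=> t [|i] /and3P[t0 tD tX]; rewrite ?mul0r ?mul1r => h1 h2.
    (* Cell 0 is empty: the origin is a dual point of the strip, so the other points keep the
       distance [d] from it. This matches the value 0 of the bound at [i = 0]. *)
    have := fibonacci_dual_separated n1 q1 tD (fibonacci_dual0 n q) (ord_pair_neq t0) _ X1 Xb.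
    by rewrite /= !subr0 !ger0_norm// -/b -/d => /(_ (ltW tX)); rewrite leNgt h2.
  have m0 : 0 < Num.max u^-1 t.2%:R by rewrite lt_max invr_gt0 u0.
  have id0 : 0 < i.+1%:R * d by rewrite mulr_gt0.
  rewrite lef_pV2 ?posrE ?exprn_gt0// lerXn2r// ?nnegrE ?(ltW m0) ?(ltW id0)//.
  by rewrite le_max h1 orbT.
- by move=> i; rewrite invr_ge0 exprn_ge0// mulr_ge0// ltW.
- move=> N; rewrite (_ : 6 * X / b = d^-1); last by rewrite /d invf_div.
  under eq_bigr do rewrite exprMn invfM.
  by rewrite -mulr_suml exprVn ler_wpM2r ?sum_inv_pow// invr_ge0 exprn_ge0// ltW.
Qed.

(** The width [W = b u / 2] makes the separation [1 / (3 u)], of the order at which the weight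
    starts to decay. Cell 0 contributes at most [u^r], cell [j] at most [(3 u / j)^r]. *)
Lemma spline_weight_sum_far (R : realType) (n r K i : nat) (q : int) (u : R) :
  let W := (fib n)%:R * u / 2 in
  (1 <= n)%N -> (2 <= r)%N -> `|q| = 1 -> 0 < u -> u <= 1 -> 1 <= W ->
  \sum_(p : 'I_K.+1 * 'I_K.+1 | [&& p != (ord0, ord0), fibonacci_dual n q p.1 p.2
      & (i%:R * W <= p.1%:R < i.+1%:R * W)]) spline_weight r u p.2
  <= u ^+ r * (1 + 2 * 3 ^+ r).
Proof.
move=> W n1 r2 q1 u0 u1 W1.
have b0 : 0 < (fib n)%:R :> R by rewrite ltr0n fib_gt0.
have Wb : W <= (fib n)%:R / 2 by rewrite /W ler_pM2r// ler_piMr// ltW.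
pose d := (3 * u)^-1.
have dE : (fib n)%:R / (6 * W) = d.
  by rewrite /d /W; field; rewrite !gt_eqF.
have d0 : 0 < d by rewrite invr_gt0 mulr_gt0.
apply: (@sum_separated_le _ _ _ (fun p : 'I_K.+1 * 'I_K.+1 => p.2%:R) _
  (fun i => u ^+ r * ((i == 0)%:R + 3 ^+ r * i%:R ^- r)) d) => //.
- move=> s t /and3P[_ sD sX] /and3P[_ tD tX] /ord_pair_neq st.
  rewrite -dE; apply: (fibonacci_dual_separated n1 q1 sD tD st _ W1 Wb).
  by move: sX tX; rewrite -natr1 mulrDl mul1r ler_norml; lra.
- move=> t j _ h1 h2.
  rewrite (_ : spline_weight r u _ = (Num.max u^-1 t.2%:R)^-1 ^+ r); last by rewrite exprVn.
  have m0 : 0 < Num.max u^-1 t.2%:R by rewrite lt_max invr_gt0 u0.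
  have le_u : (Num.max u^-1 t.2%:R)^-1 <= u.
    by rewrite invf_ple ?posrE// le_max lexx.
  case: j h1 h2 => [|j] h1 h2.
    rewrite expr0n (gtn_eqF (leq_trans _ r2))// invr0 mulr0 addr0 mulr1.
    by rewrite lerXn2r// ?nnegrE ?invr_ge0 ltW.
  rewrite add0r -exprVn -!exprMn lerXn2r// ?nnegrE ?invr_ge0 ?(ltW m0)//.
    by rewrite !mulr_ge0// ltW.
  rewrite (_ : u * _ = (j.+1%:R * d)^-1); last by rewrite invfM invrK mulrCA mulrA mulrC mulrA.
  by rewrite lef_pV2 ?posrE ?mulr_gt0// le_max h1 orbT.
- by move=> j; rewrite mulr_ge0 ?exprn_ge0 ?addr_ge0 ?mulr_ge0 ?invr_ge0 ?exprn_ge0// ltW.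
- move=> N; rewrite -mulr_sumr ler_wpM2l ?exprn_ge0 ?(ltW u0)//.
  rewrite big_split/= lerD//.
    case: N => [|N]; first by rewrite big_ord0.
    by rewrite big_ord_recl/= big1// addr0.
  by rewrite -mulr_sumr mulrC ler_wpM2r ?exprn_ge0// sum_inv_pow.
Qed.

(** If some [j <= J] has [k < 2^j / u], the least such [j] satisfies [max (1/u, k) >= 2^(j-1) / u].
    Otherwise [k >= W], and [k] lies in a block [[i W, (i + 1) W[] with [i >= 1]. *)
Lemma spline_weight_cover (R : realType) (r K J k : nat) (u W : R) :
  (0 < r)%N -> 0 < u -> 1 <= W -> W <= 2 ^+ J / u -> (k <= K)%N ->
  spline_weight r u k <=
    \sum_(j < J.+1) (2 ^+ r * (2 ^+ j / u) ^- r) * (k%:R < 2 ^+ j / u)%R%:R +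
    \sum_(i < K.+1) (i%:R * W) ^- r * (i%:R * W <= k%:R < i.+1%:R * W)%R%:R.
Proof.
move=> r0 u0 W1 WJ kK.
have X0 j : 0 < 2 ^+ j / u by rewrite divr_gt0 ?exprn_gt0.
have m0 : 0 < Num.max u^-1 k%:R by rewrite lt_max invr_gt0 u0.
have near_ge0 (j : nat) : 0 <= (2 ^+ r * (2 ^+ j / u) ^- r) * (k%:R < 2 ^+ j / u)%R%:R.
  by rewrite !mulr_ge0 ?exprn_ge0// invr_ge0 exprn_ge0// ltW.
have far_ge0 (i : nat) : 0 <= (i%:R * W) ^- r * (i%:R * W <= k%:R < i.+1%:R * W)%R%:R.
  by rewrite mulr_ge0// invr_ge0 exprn_ge0// mulr_ge0//; lra.
have [/existsP[j0 kj0]|] := boolP [exists j : 'I_J.+1, k%:R < 2 ^+ j / u].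
  apply: ler_wpDr; first exact: sumr_ge0.
  have [j kj jmin] : exists2 j : nat, (j < J.+1)%N /\ k%:R < 2 ^+ j / u &
      forall i, k%:R < 2 ^+ i / u -> (j <= i)%N.
    have ex : exists j : nat, k%:R < 2 ^+ j / u by exists j0.
    exists (ex_minn ex); case: ex_minnP => // m mk mmin; split=> //.
    by rewrite (leq_ltn_trans (mmin _ kj0)).
  case: kj => jJ kj.
  rewrite (bigD1 (Ordinal jJ))//= kj mulr1; apply: ler_wpDr; first exact: sumr_ge0.
  rewrite (_ : spline_weight r u k = (Num.max u^-1 k%:R)^-1 ^+ r); last by rewrite exprVn.
  rewrite (_ : 2 ^+ r * _ = (2 * (2 ^+ j / u)^-1) ^+ r); last by rewrite [RHS]exprMn exprVn.
  rewrite lerXn2r// ?nnegrE ?invr_ge0 ?(ltW m0)//.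
    by rewrite mulr_ge0// invr_ge0 ltW.
  rewrite -[leRHS]invrK invfM invrK lef_pV2 ?posrE ?mulr_gt0 ?invr_gt0//.
  case: j jmin {jJ kj} => [|j] jmin.
    rewrite expr0 mul1r le_max; apply/orP; left.
    by rewrite ler_piMl ?invr_ge0 ?(ltW u0)// invf_le1//; lra.
  rewrite le_max; apply/orP; right; rewrite leNgt; apply/negP => h.
  suff : (j.+1 <= j)%N by rewrite ltnn.
  by apply: jmin; rewrite (lt_le_trans h)// exprS mulrA mulrA mulVf// mul1r.
rewrite negb_exists => /forallP far.
have kW : W <= k%:R by rewrite (le_trans WJ)// leNgt; have := far ord_max.
apply: ler_wpDl; first exact: sumr_ge0.
have W0 : 0 < W by lra.
pose i := Num.truncn (k%:R / W).
have /andP[i1 i2] := @truncn_itv _ (k%:R / W) (divr_ge0 (ler0n R k) (ltW W0)).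
(* Since [1 <= W], the block index is at most [k], hence within the range of the sum. *)
have iK : (i < K.+1)%N.
  by rewrite ltnS truncn_le_nat ltr_pdivrMr// (@lt_le_trans _ _ K.+1%:R) ?ltr_nat// ler_peMr.
have i0 : (0 < i)%N by rewrite truncn_gt0 ler_pdivlMr// mul1r.
rewrite (bigD1 (Ordinal iK))//=; apply: ler_wpDr; first exact: sumr_ge0.
move: i1 i2; rewrite ler_pdivlMr// ltr_pdivrMr// -/i => i1 i2; rewrite i1 i2 mulr1.
have iW0 : 0 < i%:R * W by rewrite mulr_gt0// ltr0n.
rewrite lef_pV2 ?posrE ?exprn_gt0// lerXn2r// ?nnegrE ?(ltW iW0) ?(ltW m0)//.
by rewrite le_max i1 orbT.
Qed.

(** The weight of the first coordinate is replaced by the cover. A strip of width [X] contributes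
    [2^r X^-r * 2 (6 X / b)^r = 2 * 12^r b^-r] whatever [X] is, so the number [J + 1] of dyadic
    strips becomes the main factor. The far blocks add up to at most [2 W^-r u2^r (1 + 2 * 3^r)],
    again of order [b^-r]. *)
Lemma dual_weight_sum (R : realType) (n r K J : nat) (q : int) (u1 u2 : R) :
  let b : R := (fib n)%:R in
  (1 <= n)%N -> (2 <= r)%N -> `|q| = 1 -> 0 < u1 -> u1 <= 1 -> 0 < u2 -> u2 <= 1 ->
  1 <= b * u2 / 2 -> b * u2 / 2 <= 2 ^+ J / u1 -> 2 ^+ J / u1 <= b / 2 ->
  \sum_(p : 'I_K.+1 * 'I_K.+1 | (p != (ord0, ord0)) && fibonacci_dual n q p.1 p.2)
    spline_weight r u1 p.1 * spline_weight r u2 p.2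
  <= (2 * 12 ^+ r * J.+1%:R + 2 ^+ r.+1 * (1 + 2 * 3 ^+ r)) * b ^- r.
Proof.
move=> b n1 r2 q1 u10 u11 u20 u21; set W := b * u2 / 2 => W1 WJ Jb.
have b0 : 0 < b by rewrite ltr0n fib_gt0.
have r0 : (0 < r)%N by exact: leq_trans r2.
have W0 : 0 < W by lra.
have X0 (j : nat) : 0 < 2 ^+ j / u1 by rewrite divr_gt0 ?exprn_gt0.
pose D := fun p : 'I_K.+1 * 'I_K.+1 => (p != (ord0, ord0)) && fibonacci_dual n q p.1 p.2.
apply: (@le_trans _ _ (\sum_(p | D p)
  (\sum_(j < J.+1) (2 ^+ r * (2 ^+ j / u1) ^- r) *
     ((p.1%:R < 2 ^+ j / u1)%R%:R * spline_weight r u2 p.2) +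
   \sum_(i < K.+1) (i%:R * W) ^- r *
     ((i%:R * W <= p.1%:R < i.+1%:R * W)%R%:R * spline_weight r u2 p.2)))).
  apply: ler_sum => p _.
  have := @spline_weight_cover R r K J p.1 u1 W r0 u10 W1 WJ (ltn_ord p.1).
  move=> /(ler_wpM2r (spline_weight_ge0 r p.2 u20)) /le_trans; apply.
  rewrite mulrDl !mulr_suml le_eqVlt; apply/orP; left; apply/eqP.
  by congr (_ + _); apply: eq_bigr => i _; rewrite -[LHS]mulrA.
have filt (P : pred ('I_K.+1 * 'I_K.+1)) :
    \sum_(p | D p) ((P p)%:R * spline_weight r u2 p.2) =
    \sum_(p | [&& p != (ord0, ord0), fibonacci_dual n q p.1 p.2 & P p]) spline_weight r u2 p.2.
  rewrite (bigID P)/= [X in _ + X]big1 ?addr0; last first.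
    by move=> p /andP[_ /negbTE ->]; rewrite mul0r.
  apply: eq_big => [p|p /andP[_ ->]]; last by rewrite mul1r.
  by rewrite /D andbA.
rewrite big_split/= exchange_big/= [X in _ + X]exchange_big/= mulrDl lerD//.
  rewrite (_ : 2 * 12 ^+ r * J.+1%:R * b ^- r =
    \sum_(j < J.+1) (2 * 12 ^+ r * b ^- r)); last first.
    by rewrite sumr_const card_ord -mulr_natr; ring.
  apply: ler_sum => j _; rewrite -mulr_sumr filt.
  have Xj : 2 ^+ j / u1 <= b / 2.
    by rewrite (le_trans _ Jb)// ler_pM2r ?invr_gt0// ler_weXn2l ?ler1n// -ltnS.
  have X1 : 1 <= 2 ^+ j / u1.
    by rewrite ler_pdivlMr// mul1r (le_trans u11)// exprn_ege1// ler1n.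
  have := @spline_weight_sum_near R n r K q u2 _ n1 r2 q1 u20 X1 Xj.
  move=> H; apply: (le_trans (ler_wpM2l _ H)).
    by rewrite mulr_ge0 ?exprn_ge0// invr_ge0 exprn_ge0// ltW.
  rewrite le_eqVlt; apply/orP; left; apply/eqP; rewrite -/b.
  move: (2 ^+ j / u1) (X0 j) => x x0.
  rewrite (_ : 12 = 2 * 6 :> R); last by ring.
  rewrite -!exprVn !exprMn.
  by rewrite exprVn; field; rewrite !expf_neq0 ?gt_eqF.
rewrite (_ : 2 ^+ r.+1 * _ * _ = 2 * (W ^- r * (u2 ^+ r * (1 + 2 * 3 ^+ r)))); last first.
  have E : W ^- r * u2 ^+ r = 2 ^+ r * b ^- r.
    rewrite -!exprVn -!exprMn; congr (_ ^+ r).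
    by rewrite /W; field; rewrite !gt_eqF.
  by rewrite [W ^- r * _]mulrA E exprS; ring.
apply: (@le_trans _ _ (\sum_(i < K.+1) (i%:R ^- r) * (W ^- r * (u2 ^+ r * (1 + 2 * 3 ^+ r))))).
  apply: ler_sum => i _; rewrite -mulr_sumr filt exprMn invfM -mulrA.
  rewrite ler_wpM2l ?invr_ge0 ?exprn_ge0// ler_wpM2l ?invr_ge0 ?exprn_ge0 ?(ltW W0)//.
  exact: spline_weight_sum_far.
rewrite -mulr_suml ler_wpM2r ?sum_inv_pow//.
by rewrite !mulr_ge0 ?invr_ge0 ?exprn_ge0 ?(ltW W0) ?(ltW u20)// addr_ge0// mulr_ge0// exprn_ge0.
Qed.

(** * The quadrature error *)

Lemma exists_dyadic (R : realType) (M : R) : 1 <= M ->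
  exists J : nat, M <= 2 ^+ J /\ 2 ^+ J <= 2 * M.
Proof.
move=> M1.
have ex : exists J : nat, M <= 2 ^+ J.
  exists (Num.bound M); have M0 : 0 <= M by lra.
  rewrite (le_trans (ltW (archi_boundP M0)))// -natrX ler_nat.
  by rewrite ltnW// ltn_expl.
exists (ex_minn ex); case: ex_minnP => -[|J] MJ Jmin; split=> //; first by rewrite expr0; lra.
rewrite exprS ler_pM2l// leNgt; apply/negP => /ltW /Jmin; by rewrite ltnn.
Qed.

(** The Lipschitz bound against the value 0 at [1/2], which is at distance at most 1 from
    [recenter x]. *)
Lemma norm_periodic_spline_le1 (R : realType) (k : nat) (u x : R) : 0 < u ->
  k.+2%:R * u <= 1 -> `|periodic_spline k.+2 u x| <= 1.
Proof.
move=> u0 ku; have u1 : u <= 1.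
  have : 2 <= k.+2%:R :> R by rewrite ler_nat.
  by nra.
have h0 : smooth1 k.+2 u 2^-1 = 0.
  by apply: smooth1_eq0 => //; rewrite ger0_norm ?invr_ge0//; lra.
have := smooth1_lipschitz k (recenter x) 2^-1 u0; rewrite h0 subr0 => /le_trans; apply.
have xr := norm_recenter x.
have := ler_normB (recenter x) (2^-1).
rewrite (@ger0_norm _ 2^-1) ?invr_ge0// => h.
rewrite -[leRHS]mulr1 ler_pM ?exprn_ge0 ?(ltW u0)//; first by rewrite exprn_ile1// ltW.
by lra.
Qed.

Lemma quadrature_errorE (R : realType) (k n : nat) (a u z : R * R) :
  0 < u.1 -> 0 < u.2 -> k.+2%:R * u.1 <= 1 -> k.+2%:R * u.2 <= 1 ->
  quadrature_error k.+2 (@fibonacci_points R n) a u z =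
  u.1 ^+ k.+2 * u.2 ^+ k.+2 - (fib n)%:R^-1 * \sum_(i < fib n)
    (periodic_spline k.+2 u.1 ((fibonacci_points R i).1 - (z.1 + a.1)) *
     periodic_spline k.+2 u.2 ((fibonacci_points R i).2 - (z.2 + a.2))).
Proof.
move=> u10 u20 ku1 ku2; rewrite /quadrature_error; congr (_ - _ * _); last first.
  by apply: eq_bigr => i _; rewrite periodized_smooth_boxE//= !opprD !addrA.
transitivity (\int[@lebesgue2 R]_(x in @unit_square R)
    (periodic_spline k.+2 u.1 (x.1 - (z.1 + a.1)) *
     periodic_spline k.+2 u.2 (x.2 - (z.2 + a.2)))).
  by apply: eq_Rintegral => x _; rewrite periodized_smooth_boxE//= !opprD !addrA.
rewrite (@Rintegral_unit_square_prod R
  (fun x => periodic_spline k.+2 u.1 (x - (z.1 + a.1)))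
  (fun x => periodic_spline k.+2 u.2 (x - (z.2 + a.2)))).
- by rewrite !Rintegral_periodic_spline.
- exact/continuous_translate/periodic_spline_continuous.
- exact/continuous_translate/periodic_spline_continuous.
- by move=> x; exact: smooth1_ge0.
- by move=> x; exact: smooth1_ge0.
Qed.

Lemma quadrature_error_le (R : realType) (k n J : nat) (a u z : R * R) :
  let r := k.+2 in let b : R := (fib n)%:R in
  (1 <= n)%N -> 0 < u.1 -> 0 < u.2 -> r%:R * u.1 <= 1 -> r%:R * u.2 <= 1 ->
  1 <= b * u.2 / 2 -> b * u.2 / 2 <= 2 ^+ J / u.1 -> 2 ^+ J / u.1 <= b / 2 ->
  `|quadrature_error r (@fibonacci_points R n) a u z| <=
  4 * ((2 * 12 ^+ r * J.+1%:R + 2 ^+ r.+1 * (1 + 2 * 3 ^+ r)) * b ^- r).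
Proof.
move=> r b n1 u10 u20 ku1 ku2 W1 WJ Jb; rewrite quadrature_errorE//.
have b0 : 0 < b by rewrite ltr0n fib_gt0.
have r2 : 2 <= r%:R :> R by rewrite ler_nat.
have u11 : u.1 <= 1 by nra.
have u21 : u.2 <= 1 by nra.
(* Both splines are replaced by sums of length [N + 1], for which the dual lattice bound is
   independent of [N]. The replacement costs [1 * 4 + 5 * 4 = 24] over [N + 1]. *)
apply: (@norm_le_div_nat _ _ _ 24 1) => // N; rewrite natr1.
set s := z.1 + a.1; set t := z.2 + a.2.
pose p1 i := periodic_spline r u.1 ((@fibonacci_points R n i).1 - s).
pose p2 i := periodic_spline r u.2 ((@fibonacci_points R n i).2 - t).
pose s1 i := spline_sum r u.1 N.+1 ((@fibonacci_points R n i).1 - s).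
pose s2 i := spline_sum r u.2 N.+1 ((@fibonacci_points R n i).2 - t).
have := @quadrature_spline_sum R n r N.+1 u.1 u.2 s t u10 u20.
rewrite -/b -/(\sum_(i < fib n) (s1 i * s2 i)) => H1.
have eps0 : 0 <= 4 / N.+1%:R :> R by rewrite divr_ge0.
have eps4 : 4 / N.+1%:R <= 4 :> R by rewrite ler_pdivrMr// ler_peMr// ler1n.
have close (v x : R) : 0 < v -> v <= 1 -> r%:R * v <= 1 ->
    `|periodic_spline r v x - spline_sum r v N.+1 x| <= 4 / N.+1%:R.
  move=> v0 v1 rv; apply: (le_trans (periodic_spline_sum x _ v0 rv)) => //.
  by rewrite ler_piMl// exprn_ile1// ltW.
have H2 i : `|p1 i * p2 i - s1 i * s2 i| <= 24 / N.+1%:R.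
  have c1 : `|p1 i - s1 i| <= 4 / N.+1%:R by exact: close.
  have c2 : `|p2 i - s2 i| <= 4 / N.+1%:R by exact: close.
  have d1 : `|p1 i| <= 1 by exact: norm_periodic_spline_le1.
  have d2 : `|p2 i| <= 1 by exact: norm_periodic_spline_le1.
  have e2 : `|s2 i| <= 5.
    have -> : s2 i = p2 i - (p2 i - s2 i) by ring.
    rewrite (le_trans (ler_normB _ _))// (_ : 5 = 1 + 4 :> R); last by ring.
    by rewrite lerD// (le_trans c2 eps4).
  rewrite (_ : _ - _ = p1 i * (p2 i - s2 i) + s2 i * (p1 i - s1 i)); last by ring.
  rewrite (le_trans (ler_normD _ _))// !normrM.
  rewrite (_ : 24 / _ = 1 * (4 / N.+1%:R) + 5 * (4 / N.+1%:R)); last by ring.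
  by rewrite lerD// ler_pM.
have H3 : `|b^-1 * (\sum_(i < fib n) s1 i * s2 i) - b^-1 * \sum_(i < fib n) p1 i * p2 i|
    <= 24 / N.+1%:R.
  rewrite -mulrBr -sumrB normrM ger0_norm ?invr_ge0 ?(ltW b0)// ler_pdivrMl//.
  rewrite (le_trans (ler_norm_sum _ _ _))//.
  rewrite (_ : b * _ = \sum_(i < fib n) 24 / N.+1%:R); last first.
    by rewrite sumr_const card_ord -[RHS]mulr_natl.
  by apply: ler_sum => i _; rewrite -normrN opprB.
have D1 := @dual_weight_sum R n r N.+1 J 1 u.1 u.2 n1 isT (normr1 _) u10 u11 u20 u21 W1 WJ Jb.
have D2 := @dual_weight_sum R n r N.+1 J (-1) u.1 u.2 n1 isT (normrN1 _) u10 u11 u20 u21 W1 WJ Jb.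
move: D1 D2; rewrite -/b; set Z := (_ + _) * b ^- r => D1 D2.
rewrite (_ : _ - _ = (u.1 ^+ r * u.2 ^+ r - b^-1 * \sum_(i < fib n) s1 i * s2 i)
  + (b^-1 * (\sum_(i < fib n) s1 i * s2 i) - b^-1 * \sum_(i < fib n) p1 i * p2 i)); last by ring.
rewrite (le_trans (ler_normD _ _))// lerD// (le_trans H1)//.
under eq_bigr do rewrite mulrDr.
rewrite big_split/=.
have filt (q : int) : \sum_(p : 'I_N.+2 * 'I_N.+2 | p != (ord0, ord0))
    spline_weight r u.1 p.1 * spline_weight r u.2 p.2 * (fibonacci_dual n q p.1 p.2)%:R =
  \sum_(p : 'I_N.+2 * 'I_N.+2 | (p != (ord0, ord0)) && fibonacci_dual n q p.1 p.2)
    spline_weight r u.1 p.1 * spline_weight r u.2 p.2.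
  rewrite [RHS]big_mkcondr; apply: eq_bigr => p _.
  by case: ifP; rewrite ?mulr1 ?mulr0.
(* The two signs of [q] contribute [Z] each. *)
rewrite !filt (_ : 4 * Z = 2 * (Z + Z)); last by ring.
by rewrite ler_pM2l// lerD.
Qed.

(** * From a pointwise error bound to the discrepancy *)

Lemma Lnorm_infty_le (d : measure_display) (T : measurableType d) (R : realType)
    (mu : {measure set T -> \bar R}) (f : T -> R) (M : R) : 0 <= M ->
  (forall x, `|f x| <= M) -> (Lnorm mu +oo (EFin \o f) <= M%:E)%E.
Proof.
move=> M0 fM; rewrite unlock; case: ifP => _; last by rewrite lee_fin.
by apply/ess_supP; apply: aeW => x /=; rewrite lee_fin.
Qed.

(** A side longer than 1 would put into the box, besides its lower corner, the point one unit
    further, which the half-open square cannot contain. *)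
Lemma admissible_box_side (R : realType) (r : nat) (v : R) (a u : R * R) :
  (0 < r)%N -> admissible_box r v (a, u) -> r%:R * u.1 <= 1 /\ r%:R * u.2 <= 1.
Proof.
move=> r0 [/= u10 u20 sub _].
have s1 : 0 < r%:R * u.1 by rewrite mulr_gt0// ltr0n.
have s2 : 0 < r%:R * u.2 by rewrite mulr_gt0// ltr0n.
pose x := a.1 - r%:R * u.1 / 2; pose y := a.2 - r%:R * u.2 / 2.
have inbox (p q : R) : x <= p -> p < x + r%:R * u.1 -> y <= q -> q < y + r%:R * u.2 ->
    [/\ 0 <= p, p < 1, 0 <= q & q < 1].
  move=> h1 h2 h3 h4; have [] : @unit_square R (p, q).
    by apply: sub; split; rewrite /= in_itv/=; move: h1 h2 h3 h4; rewrite /x /y; lra.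
  by rewrite /= !in_itv/= => /andP[? ?] /andP[? ?].
have [] := inbox x y (lexx _) _ (lexx _) _; rewrite ?ltrDl// => x0 _ y0 _.
split; rewrite leNgt; apply/negP => h.
- have [] := inbox (x + 1) y _ _ (lexx _) _; rewrite ?ltrDl ?lerDl ?ltrD2l//; lra.
- have [] := inbox x (y + 1) (lexx _) _ _ _; rewrite ?ltrDl ?lerDl ?ltrD2l//; lra.
Qed.

Theorem theorem1p3 (R : realType) (r : nat) (hr : (2 <= r)%N) :
  exists c C : R, [/\ 0 < c, 0 < C &
    forall (n : nat) (v : R), (1 <= n)%N -> 0 < v -> v <= 1 ->
      c / (fib n)%:R <= v ->
      (smooth_discrepancy r +oo (@fibonacci_points R n) v
         <= (C * (ln ((fib n)%:R * v) / (fib n)%:R ^+ r))%:E)%E].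
Proof.
case: r hr => [|[|k]] // _; set r := k.+2.
pose A : R := 2 * 12 ^+ r; pose B : R := 2 ^+ r.+1 * (1 + 2 * 3 ^+ r).
have A0 : 0 < A by rewrite mulr_gt0// exprn_gt0.
have B0 : 0 < B by rewrite mulr_gt0 ?exprn_gt0// addr_gt0// mulr_gt0// exprn_gt0.
have ln20 : 0 < ln 2 :> R by rewrite ln_gt0// ltr1n.
have rr2 : 2 <= r%:R :> R by rewrite ler_nat.
(* As [v = r^2 u1 u2], the choice of [c] means [b u1 u2 >= 2], that is [M >= 1] below. The constant
   [C] collects [4 (A + B) (J + 1)] and [J + 1 <= 2 ln (b v) / ln 2]. *)
exists (2 * r%:R ^+ 2), (8 * (A + B) / ln 2); split.
- by rewrite mulr_gt0// exprn_gt0// ltr0n.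
- by rewrite divr_gt0// mulr_gt0// addr_gt0.
move=> n v n1 v0 v1; have b0 : 0 < (fib n)%:R :> R by rewrite ltr0n fib_gt0.
rewrite ler_pdivrMr// [leRHS]mulrC; set b : R := (fib n)%:R in b0 * => cv.
have bv2 : 2 <= b * v.
  by rewrite (le_trans _ cv)// ler_peMr// exprn_ege1//; lra.
have lnbv : ln 2 <= ln (b * v) by rewrite ler_ln ?posrE//; lra.
apply: ub_ereal_sup => _ [[a u] adm <-].
have [ru1 ru2] := admissible_box_side (isT : (0 < r)%N) adm.
case: adm => /= u10 u20 _; rewrite /box_vol => vE.
have u11 : u.1 <= 2^-1 by nra.
have u21 : u.2 <= 2^-1 by nra.
have uu : u.1 * u.2 <= v.
  by rewrite -vE ler_peMl ?mulr_ge0 ?(ltW u10) ?(ltW u20)// exprn_ege1//; lra.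
(* Dividing [M <= 2^J <= 2 M] by [u1] gives [b u2 / 2 <= 2^J / u1 <= b u2], and [b u2 <= b / 2]
   because [r >= 2] forces [u2 <= 1/2]. *)
pose M := b * (u.1 * u.2) / 2.
have M1 : 1 <= M.
  have r20 : 0 < r%:R ^+ 2 :> R by rewrite exprn_gt0// ltr0n.
  by move: cv; rewrite -vE [leRHS]mulrCA [leLHS]mulrC ler_pM2l// /M; lra.
have [J [MJ JM]] := exists_dyadic M1.
have ME : M / u.1 = b * u.2 / 2 by rewrite /M; field; rewrite gt_eqF.
(* Here [2^J <= 2 M = b u1 u2 <= b v]. The extra 1 in [J + 1] is absorbed by [ln 2 <= ln (b v)]. *)
have lnJ : J%:R * ln 2 <= ln (b * v).
  rewrite mulr_natl -lnXn// ler_ln ?posrE ?exprn_gt0 ?mulr_gt0//.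
  apply: (le_trans JM); rewrite /M mulrC divfK ?pnatr_eq0//.
  by rewrite ler_pM2l.
have Jbound : J.+1%:R <= 2 * ln (b * v) / ln 2.
  by rewrite ler_pdivlMr// -natr1 mulrDl mul1r; lra.
have lnbv0 : 0 < ln (b * v) by exact: lt_le_trans ln20 lnbv.
have AB0 : 0 < A + B by rewrite addr_gt0.
have br0 : 0 < b ^- r by rewrite invr_gt0 exprn_gt0.
apply: Lnorm_infty_le.
  by rewrite ltW// !mulr_gt0// invr_gt0.
have W1 : 1 <= b * u.2 / 2 by rewrite -ME ler_pdivlMr//; nra.
have WJ : b * u.2 / 2 <= 2 ^+ J / u.1 by rewrite -ME ler_pM2r ?invr_gt0.
have Jb : 2 ^+ J / u.1 <= b / 2.
  rewrite (@le_trans _ _ (2 * M / u.1)) ?ler_pM2r ?invr_gt0//.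
  by rewrite -mulrA ME; nra.
move=> z; have := @quadrature_error_le R k n J a u z n1 u10 u20 ru1 ru2 W1 WJ Jb.
rewrite -/r -/b -/A -/B => /le_trans; apply.
rewrite mulrA [leRHS]mulrA ler_pM2r//.
have J1 : 1 <= J.+1%:R :> R by rewrite ler1n.
apply: (@le_trans _ _ (4 * ((A + B) * J.+1%:R))).
  by rewrite ler_pM2l// mulrDl lerD2l ler_peMr// ltW.
rewrite (_ : _ / _ * _ = 4 * ((A + B) * (2 * ln (b * v) / ln 2))); last by ring.
by rewrite ler_pM2l// ler_pM2l.
Qed.
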